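(* Consider system (5) in the standing setup, with a fixed switching signal $\sigma$ (satisfying the dwell-time assumption) and fixed weight functions $a_{ij},b_{ij}$. Then system (5) is SISS with respect to the moving set $\mathcal L(y(t))$ with input $z$ if and only if $\mathcal G_{\sigma(t)}$ is uniformly jointly L-connected (UJLC).
   Context: Standing setup. Fix integers $n\ge 2$, $k\ge 1$, $d\ge 1$. The follower set is $\mathcal V_F=\{1,\dots,n\}$ and the leader set is $\mathcal V_L=\{\hat 1,\dots,\hat k\}$ (disjoint from $\mathcal V_F$); $\mathcal V=\mathcal V_F\cup\mathcal V_L$. The interaction topology is a time-varying digraph $\mathcal G_{\sigma(t)}=(\mathcal V,\mathcal E_{\sigma(t)})$, where $\sigma:[0,\infty)\to\mathcal P$ is a piecewise constant switching signal taking values in a finite set $\mathcal P$ of digraphs on $\mathcal V$; no arc of any of these digraphs enters a leader. An arc $(j,i)$ means that $i$ receives information from $j$. Dwell-time assumption: any two consecutive switching instants of $\sigma$ are separated by at least $\tau_D>0$. For $i\in\mathcal V_F$, $N_i(\sigma(t))=\{j\in\mathcal V_F:(j,i)\in\mathcal E_{\sigma(t)}\}$ and $L_i(\sigma(t))=\{j\in\mathcal V_L:(j,i)\in\mathcal E_{\sigma(t)}\}$. $\mathcal G^F_{\sigma(t)}$ denotes the subgraph of $\mathcal G_{\sigma(t)}$ induced on $\mathcal V_F$. For $0\le t_1<t_2\le\infty$ the joint graph is $\mathcal G([t_1,t_2))=(\mathcal V,\bigcup_{t\in[t_1,t_2)}\mathcal E_{\sigma(t)})$, and $\mathcal G^F([t_1,t_2))$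 is its subgraph induced on $\mathcal V_F$. System (5): $\dot y_i=u_i(y,t)$ for $i=1,\dots,k$, and $\dot x_i=\sum_{j\in N_i(\sigma(t))}a_{ij}(x,y,t)(x_j-x_i)+\sum_{j\in L_i(\sigma(t))}b_{ij}(x,y,t)(y_j-x_i)+w_i(t)$ for $i=1,\dots,n$, where $x_i,y_j\in\mathbb R^d$, $x=(x_1,\dots,x_n)$, $y=(y_1,\dots,y_k)$; each $u_i(y,t)$ is continuous in $y$ and piecewise continuous in $t$; each $w_i$ is continuous; the weights $a_{ij},b_{ij}$ are continuous and satisfy $a_*\le a_{ij}(x,y,t)\le a^*$, $b_{ij}(x,y,t)\ge b_*$ for all $x,y,t$, with constants $0<a_*\le a^*$, $b_*>0$. Initial time is $0$, $x^0=x(0)$, $y^0=y(0)$. Along a trajectory, $z(t)=(u_1(y(t),t),\dots,u_k(y(t),t),w_1(t),\dots,w_n(t))\in\mathbb R^{(n+k)d}$ and $\|z\|_\infty=\sup_{t\ge0}|z(t)|$. Set notation: $|\cdot|$ is the Euclidean norm; for a closed convex $K\subset\mathbb R^d$, $|v|_K=\inf_{p\in K}|v-p|$; $\mathcal L(y(t))=\mathrm{co}\{y_1(t),\dots,y_k(t)\}$ (convex hull); $|x(t)|_{\mathcal L(y(t))}=\max_{i\in\mathcal V_F}|x_i(t)|_{\mathcal L(y(t))}$. Connectivity: a digraph on $\mathcal V$ is L-connected if for every $i\in\mathcal V_F$ there is a directed path from some leader $j\in\mathcal V_L$ to $i$. $\mathcal G_{\sigma(t)}$ is jointly L-connected (JLC)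 if $\mathcal G([t,\infty))$ is L-connected for every $t\ge0$; it is uniformly jointly L-connected (UJLC) if there is $T>0$ such that $\mathcal G([t,t+T))$ is L-connected for every $t\ge0$. SISS: system (5) is (globally, generalized) set input-to-state stable with respect to $\mathcal L(y(t))$ with input $z$ if there exist a class-$\mathcal{KL}$ function $\beta$ and a class-$\mathcal K$ function $\gamma$ such that for all admissible $u_i,w_i$ with $\|z\|_\infty<\infty$ and all initial conditions $x^0\in\mathbb R^{nd}$, $y^0\in\mathbb R^{kd}$: $|x(t)|_{\mathcal L(y(t))}\le\beta(|x^0|_{\mathcal L(y^0)},t)+\gamma(\|z\|_\infty)$ for all $t\ge0$. *)

(* Defs.v *)
From Stdlib Require Import Reals Lra Lia List ClassicalEpsilon.
Open Scope R_scope.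

Fixpoint rsum (m : nat) (f : nat -> R) : R :=
  match m with O => 0 | S p => rsum p f + f p end.

Fixpoint rmax_upto (m : nat) (f : nat -> R) : R :=
  match m with O => 0 | S p => Rmax (rmax_upto p f) (f p) end.

(* ---------- vectors of R^d are functions nat -> R (coords 0..d-1);
   stacked states x : nat -> nat -> R, x i c = c-th coordinate of agent i ---------- *)
Definition vnorm (d : nat) (v : nat -> R) : R := sqrt (rsum d (fun c => v c ^ 2)).

Definition sdist (m d : nat) (x x' : nat -> nat -> R) : R :=
  sqrt (rsum m (fun i => rsum d (fun c => (x i c - x' i c) ^ 2))).

Definition is_inf (S : R -> Prop) (r : R) : Prop :=
  (forall s, S s -> r <= s) /\ (forall b, (forall s, S s -> b <= s) -> b <= r).

Definition inf_of (S : R -> Prop) : R := epsilon (inhabits 0) (fun r => is_inf S r).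
Definition sup_of (S : R -> Prop) : R := epsilon (inhabits 0) (fun r => is_lub S r).

Definition in_hull (k d : nat) (y : nat -> nat -> R) (p : nat -> R) : Prop :=
  exists lam : nat -> R,
    (forall j, (j < k)%nat -> 0 <= lam j) /\ rsum k lam = 1 /\
    (forall c, (c < d)%nat -> p c = rsum k (fun j => lam j * y j c)).

Definition hull_dist (k d : nat) (y : nat -> nat -> R) (v : nat -> R) : R :=
  inf_of (fun s => exists p, in_hull k d y p /\ s = vnorm d (fun c => v c - p c)).

Definition Ldist (n k d : nat) (x y : nat -> nat -> R) : R :=
  rmax_upto n (fun i => hull_dist k d y (x i)).

(* ---------- digraphs on V = V_F ∪ V_L with no arc entering a leader ----------
   arcF g j i : arc (j,i) from follower j to follower i  (i, j < n)
   arcL g j i : arc (hat j, i) from leader hat j to follower i (j < k, i < n) *)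
Record digraph : Type := mkDigraph {
  arcF : nat -> nat -> bool ;
  arcL : nat -> nat -> bool }.

Definition dwell_time (sigma : R -> digraph) (tauD : R) : Prop :=
  exists s : nat -> R, s O = 0 /\ (forall m, s m + tauD <= s (S m)) /\
    (forall m t, s m <= t < s (S m) -> sigma t = sigma (s m)).

Definition finite_valued (sigma : R -> digraph) : Prop :=
  exists P : list digraph, forall t, 0 <= t -> In (sigma t) P.

Definition jointF (sigma : R -> digraph) (t1 t2 : R) (j i : nat) : Prop :=
  exists t, t1 <= t < t2 /\ arcF (sigma t) j i = true.
Definition jointL (sigma : R -> digraph) (t1 t2 : R) (j i : nat) : Prop :=
  exists t, t1 <= t < t2 /\ arcL (sigma t) j i = true.

Inductive reach (n k : nat) (EF EL : nat -> nat -> Prop) : nat -> Prop :=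
  | reach_leader : forall j i, (j < k)%nat -> (i < n)%nat -> EL j i -> reach n k EF EL i
  | reach_step : forall j i, reach n k EF EL j -> (i < n)%nat -> EF j i -> reach n k EF EL i.

Definition L_connected (n k : nat) (EF EL : nat -> nat -> Prop) : Prop :=
  forall i, (i < n)%nat -> reach n k EF EL i.

Definition UJLC (n k : nat) (sigma : R -> digraph) : Prop :=
  exists T, 0 < T /\ forall t, 0 <= t ->
    L_connected n k (jointF sigma t (t + T)) (jointL sigma t (t + T)).

Definition cont_nonneg (f : R -> R) : Prop :=
  forall r, 0 <= r -> forall eps, 0 < eps -> exists delta, 0 < delta /\
    forall s, 0 <= s -> Rabs (s - r) < delta -> Rabs (f s - f r) < eps.

Definition classK (g : R -> R) : Prop :=
  cont_nonneg g /\ g 0 = 0 /\ (forall r s, 0 <= r -> r < s -> g r < g s).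

Definition classKL (beta : R -> R -> R) : Prop :=
  (forall t, 0 <= t -> classK (fun r => beta r t)) /\
  (forall r, 0 <= r ->
     (forall t1 t2, 0 <= t1 -> t1 <= t2 -> beta r t2 <= beta r t1) /\
     (forall eps, 0 < eps -> exists T, forall t, T <= t -> Rabs (beta r t) < eps)).

Definition cont_xyt (n k d : nat)
  (g : (nat -> nat -> R) -> (nat -> nat -> R) -> R -> R) : Prop :=
  forall x y t eps, 0 < eps -> exists delta, 0 < delta /\
    forall x' y' t', sdist n d x x' + sdist k d y y' + Rabs (t' - t) < delta ->
      Rabs (g x' y' t' - g x y t) < eps.

Definition cont_y (k d : nat) (g : (nat -> nat -> R) -> R) : Prop :=
  forall y eps, 0 < eps -> exists delta, 0 < delta /\
    forall y', sdist k d y y' < delta -> Rabs (g y' - g y) < eps.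

Definition pw_cont (f : R -> R) : Prop :=
  exists p : nat -> R, p O = 0 /\ (forall m, p m < p (S m)) /\
    (forall M, exists m, M < p m) /\
    forall m,
      (forall t, p m < t < p (S m) -> continuity_pt f t) /\
      (exists L, forall eps, 0 < eps -> exists delta, 0 < delta /\
         forall s, p m < s < p m + delta -> Rabs (f s - L) < eps) /\
      (exists L, forall eps, 0 < eps -> exists delta, 0 < delta /\
         forall s, p (S m) - delta < s < p (S m) -> Rabs (f s - L) < eps).

(* Types: weights a i j x y t ; leader inputs u i y t c ; disturbances w i t c *)
Definition weight := nat -> nat -> (nat -> nat -> R) -> (nat -> nat -> R) -> R -> R.
Definition leader_input := nat -> (nat -> nat -> R) -> R -> nat -> R.
Definition disturbance := nat -> R -> nat -> R.
Definition trajectory := R -> nat -> nat -> R.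

Definition weights_ok (n k d : nat) (a b : weight) (a_lo a_hi b_lo : R) : Prop :=
  (forall i j, (i < n)%nat -> (j < n)%nat ->
     cont_xyt n k d (a i j) /\ forall x y t, a_lo <= a i j x y t <= a_hi) /\
  (forall i j, (i < n)%nat -> (j < k)%nat ->
     cont_xyt n k d (b i j) /\ forall x y t, b_lo <= b i j x y t).

Definition admissible_u (k d : nat) (u : leader_input) : Prop :=
  forall i c, (i < k)%nat -> (c < d)%nat ->
    (forall t, 0 <= t -> cont_y k d (fun y => u i y t c)) /\
    (forall y, pw_cont (fun t => u i y t c)).

Definition admissible_w (n d : nat) (w : disturbance) : Prop :=
  forall i c, (i < n)%nat -> (c < d)%nat -> continuity (fun t => w i t c).

Definition rhs_x (n k : nat) (sigma : R -> digraph) (a b : weight) (w : disturbance)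
  (xt yt : nat -> nat -> R) (t : R) (i c : nat) : R :=
  rsum n (fun j => if arcF (sigma t) j i then a i j xt yt t * (xt j c - xt i c) else 0)
  + rsum k (fun j => if arcL (sigma t) j i then b i j xt yt t * (yt j c - xt i c) else 0)
  + w i t c.

Definition is_solution (n k d : nat) (sigma : R -> digraph) (a b : weight)
  (u : leader_input) (w : disturbance) (x y : trajectory) : Prop :=
  (forall i c, (i < n)%nat -> (c < d)%nat -> cont_nonneg (fun t => x t i c)) /\
  (forall i c, (i < k)%nat -> (c < d)%nat -> cont_nonneg (fun t => y t i c)) /\
  exists e : nat -> R, forall t, 0 < t -> (forall m, t <> e m) ->
    (forall i c, (i < n)%nat -> (c < d)%nat ->
       derivable_pt_lim (fun s => x s i c) t (rhs_x n k sigma a b w (x t) (y t) t i c)) /\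
    (forall i c, (i < k)%nat -> (c < d)%nat ->
       derivable_pt_lim (fun s => y s i c) t (u i (y t) t c)).

Definition znorm (n k d : nat) (u : leader_input) (w : disturbance) (y : trajectory)
  (t : R) : R :=
  sqrt (rsum k (fun i => rsum d (fun c => (u i (y t) t c) ^ 2))
        + rsum n (fun i => rsum d (fun c => (w i t c) ^ 2))).

Definition z_bounded (n k d : nat) (u : leader_input) (w : disturbance) (y : trajectory) : Prop :=
  exists M, forall t, 0 <= t -> znorm n k d u w y t <= M.

Definition z_supnorm (n k d : nat) (u : leader_input) (w : disturbance) (y : trajectory) : R :=
  sup_of (fun s => exists t, 0 <= t /\ s = znorm n k d u w y t).

Definition SISS (n k d : nat) (sigma : R -> digraph) (a b : weight) : Prop :=
  exists beta gamma, classKL beta /\ classK gamma /\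
    forall (u : leader_input) (w : disturbance) (x y : trajectory),
      admissible_u k d u -> admissible_w n d w ->
      is_solution n k d sigma a b u w x y ->
      z_bounded n k d u w y ->
      forall t, 0 <= t ->
        Ldist n k d (x t) (y t) <=
          beta (Ldist n k d (x 0) (y 0)) t + gamma (z_supnorm n k d u w y).

(* Main.v *)
Require Import Defs.
From Stdlib Require Import Reals.
From Coquelicot Require Import Coquelicot.
From Stdlib Require Import Reals Lra Lia Arith List ClassicalEpsilon Classical Cantor
  FunctionalExtensionality.
Open Scope R_scope.

(** Sufficiency. Fix an initial time t0 and a unit direction p, and let m be the maximum of
    p.y_j(t0), R the distance of the followers to the hull at t0 and Z the bound on the input.
    The gaps th_i(t) = m + R + Z (t - t0) - p.x_i(t) are nonnegative at t0 and form a
    supersolution of the consensus dynamics in which every leader sits at level at least R.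
    Hence they stay nonnegative, decay at most exponentially, and grow to a fixed fraction of R
    along every arc that stays active for half a dwell time. Over n consecutive windows, joint
    connectivity spreads this to all followers, so th_i >= mu R with mu independent of p. Since
    the distance to a hull is governed by support functions, it contracts by 1 - mu up to an
    error proportional to Z.

    Necessity. With all leaders at the origin and a disturbance between 1/2 and 3/2 in the first
    coordinate, set input-to-state stability bounds the followers uniformly. If some followers
    receive no information from outside during a long interval, their minimum grows at rate at
    least 1/2 there, which contradicts the bound. As the weights are only continuous, the driven
    trajectory comes from an Euler scheme whose residual is absorbed in the disturbance. *)

(** * Finite sums *)

(** The distance to a moving hull has no convenient derivative. Working in one direction p at a time
    makes the system a scalar consensus equation, and only constants independent of p survive the
    passage back to the distance. Leader weights have no upper bound, so in the sufficiency part
    their terms are used through sign and lower bound only. This is why each comparison is tested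
    only where the compared quantity lies below its barrier: there the leaders can only push it up.
    Derivatives exist outside a sequence of times that may be dense, so one cannot argue interval by
    interval; all comparisons rest on a barrier lemma that tolerates countable exceptional sets. In
    the necessity part, freedom in the disturbance replaces solving the equation for a prescribed
    one. The price is that the disturbance must be continuous although the graph jumps. *)

Lemma rsum_ext m f g : (forall i, (i < m)%nat -> f i = g i) -> rsum m f = rsum m g.
Proof.
  induction m as [|m IH]; simpl; intros H; [reflexivity|].
  rewrite IH by (intros; apply H; lia). rewrite H by lia. reflexivity.
Qed.

Lemma rsum_le m f g : (forall i, (i < m)%nat -> f i <= g i) -> rsum m f <= rsum m g.
Proof.
  induction m as [|m IH]; simpl; intros H; [lra|].
  apply Rplus_le_compat; [apply IH; intros; apply H; lia | apply H; lia].
Qed.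

Lemma rsum_plus m f g : rsum m (fun i => f i + g i) = rsum m f + rsum m g.
Proof. induction m as [|m IH]; simpl; [ring | rewrite IH; ring]. Qed.

Lemma rsum_scal m c f : rsum m (fun i => c * f i) = c * rsum m f.
Proof. induction m as [|m IH]; simpl; [ring | rewrite IH; ring]. Qed.

Lemma rsum_const m c : rsum m (fun _ => c) = INR m * c.
Proof.
  induction m as [|m IH]; [simpl; ring|].
  rewrite S_INR. simpl rsum. rewrite IH. ring.
Qed.

Lemma rsum_0 m f : (forall i, (i < m)%nat -> f i = 0) -> rsum m f = 0.
Proof.
  intros H. rewrite (rsum_ext m f (fun _ => 0) H), rsum_const. ring.
Qed.

Lemma rsum_nonneg m f : (forall i, (i < m)%nat -> 0 <= f i) -> 0 <= rsum m f.
Proof.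
  intros H. rewrite <- (rsum_0 m (fun _ => 0)) by reflexivity. now apply rsum_le.
Qed.

Lemma rsum_minus m f g : rsum m (fun i => f i - g i) = rsum m f - rsum m g.
Proof. induction m as [|m IH]; simpl; [ring | rewrite IH; ring]. Qed.

Lemma rsum_ge_term m f i : (forall j, (j < m)%nat -> 0 <= f j) -> (i < m)%nat -> f i <= rsum m f.
Proof.
  induction m as [|m IH]; simpl; intros H Hi; [lia|].
  destruct (Nat.eq_dec i m) as [->|Hne].
  - assert (0 <= rsum m f) by (apply rsum_nonneg; intros; apply H; lia). lra.
  - assert (f i <= rsum m f) by (apply IH; [intros; apply H; lia | lia]).
    assert (0 <= f m) by (apply H; lia). lra.
Qed.

Lemma rsum_abs_le m f g :
  (forall i, (i < m)%nat -> Rabs (f i) <= g i) -> Rabs (rsum m f) <= rsum m g.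
Proof.
  induction m as [|m IH]; simpl; intros H; [rewrite Rabs_R0; lra|].
  eapply Rle_trans; [apply Rabs_triang|].
  apply Rplus_le_compat; [apply IH; intros; apply H; lia | apply H; lia].
Qed.

Lemma rsum_swap m p f :
  rsum m (fun i => rsum p (fun j => f i j)) = rsum p (fun j => rsum m (fun i => f i j)).
Proof.
  induction m as [|m IH]; simpl.
  - symmetry. now apply rsum_0.
  - rewrite IH, <- rsum_plus. reflexivity.
Qed.

(** * Finite maxima and common radii *)

Lemma rmax_upto_ge m f i : (i < m)%nat -> f i <= rmax_upto m f.
Proof.
  induction m as [|m IH]; simpl; intros Hi; [lia|].
  destruct (Nat.eq_dec i m) as [->|Hne]; [apply Rmax_r|].
  eapply Rle_trans; [apply IH; lia | apply Rmax_l].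
Qed.

Lemma rmax_upto_lub m f r : 0 <= r -> (forall i, (i < m)%nat -> f i <= r) -> rmax_upto m f <= r.
Proof.
  intros Hr. induction m as [|m IH]; simpl; intros H; [lra|].
  apply Rmax_lub; [apply IH; intros; apply H; lia | apply H; lia].
Qed.

Lemma rmax_upto_nonneg m f : 0 <= rmax_upto m f.
Proof.
  induction m as [|m IH]; simpl; [lra|]. eapply Rle_trans; [apply IH | apply Rmax_l].
Qed.

Lemma exists_argmax m (f : nat -> R) : (1 <= m)%nat ->
  exists j, (j < m)%nat /\ forall i, (i < m)%nat -> f i <= f j.
Proof.
  induction m as [|m IH]; intros Hm; [lia|].
  destruct (Nat.eq_dec m 0) as [->|Hm0].
  - exists 0%nat. split; [lia|]. intros i Hi. replace i with 0%nat by lia. lra.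
  - destruct IH as [j [Hj Hmax]]; [lia|].
    destruct (Rle_dec (f m) (f j)) as [Hle|Hgt].
    + exists j. split; [lia|]. intros i Hi.
      destruct (Nat.eq_dec i m) as [->|]; [lra | apply Hmax; lia].
    + exists m. split; [lia|]. intros i Hi.
      destruct (Nat.eq_dec i m) as [->|]; [lra|].
      assert (f i <= f j) by (apply Hmax; lia). lra.
Qed.

Lemma common_delta m (P : nat -> R -> Prop) :
  (forall i d d', P i d -> 0 < d' <= d -> P i d') ->
  (forall i, (i < m)%nat -> exists d, 0 < d /\ P i d) ->
  exists d, 0 < d /\ forall i, (i < m)%nat -> P i d.
Proof.
  intros Hmono. induction m as [|m IH]; intros H.
  - exists 1. split; [lra | intros; lia].
  - destruct IH as [d1 [Hd1 H1]]; [intros; apply H; lia|].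
    destruct (H m) as [d2 [Hd2 H2]]; [lia|].
    assert (Hmin : 0 < Rmin d1 d2) by now apply Rmin_pos.
    exists (Rmin d1 d2). split; [exact Hmin|]. intros i Hi.
    destruct (Nat.eq_dec i m) as [->|Hne].
    + apply (Hmono m d2); [exact H2 | split; [exact Hmin | apply Rmin_r]].
    + apply (Hmono i d1); [apply H1; lia | split; [exact Hmin | apply Rmin_l]].
Qed.

(** * Differential inequalities with countably many exceptional times *)

(** One step of Cantor's nested intervals: of the two outer closed quarters, the one on the far side
    of the midpoint from [x] is kept, so it misses [x]. *)
Definition tear (x : R) (I : R * R) : R * R :=
  if Rle_dec x ((fst I + snd I) / 2) then ((fst I + 3 * snd I) / 4, snd I)
  else (fst I, (3 * fst I + snd I) / 4).

Lemma interval_avoids_sequence (v : nat -> R) a b : a < b ->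
  exists y, a < y < b /\ forall m, y <> v m.
Proof.
  intros Hab.
  (* Starting from the middle half places the limit strictly between [a] and [b]. *)
  set (I := fix I m := match m with O => ((3 * a + b) / 4, (a + 3 * b) / 4) | S p => tear (v p) (I p) end).
  assert (Hlt : forall m, fst (I m) < snd (I m)).
  { induction m as [|m IH]; simpl; [lra|]. unfold tear.
    destruct (Rle_dec _ _); simpl; lra. }
  assert (Hmono : forall m, fst (I m) <= fst (I (S m)) /\ snd (I (S m)) <= snd (I m)).
  { intros m. specialize (Hlt m). simpl. unfold tear. destruct (Rle_dec _ _); simpl; lra. }
  assert (Hmon2 : forall m p, fst (I m) <= fst (I (m + p)%nat) /\ snd (I (m + p)%nat) <= snd (I m)).
  { intros m p. induction p as [|p IH]; [rewrite Nat.add_0_r; lra|].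
    rewrite Nat.add_succ_r. specialize (Hmono (m + p)%nat). lra. }
  assert (Hcross : forall m p, fst (I m) < snd (I p)).
  { intros m p. destruct (Hmon2 m p) as [H1 _]. destruct (Hmon2 p m) as [_ H2].
    rewrite (Nat.add_comm p m) in H2. specialize (Hlt (m + p)%nat). lra. }
  destruct (completeness (fun r => exists m, r = fst (I m))) as [y [Hub Hlub]].
  { exists (snd (I 0%nat)). intros r [m ->]. apply Rlt_le, Hcross. }
  { exists (fst (I 0%nat)), 0%nat. reflexivity. }
  assert (Hy : forall m, fst (I m) <= y <= snd (I m)).
  { intros m. split; [apply Hub; now exists m|].
    apply Hlub. intros r [p ->]. apply Rlt_le, Hcross. }
  exists y. split.
  - specialize (Hy 0%nat). simpl in Hy. lra.
  - intros m ->. specialize (Hy (S m)). specialize (Hlt m). simpl in Hy. unfold tear in Hy.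
    destruct (Rle_dec _ _); simpl in Hy; lra.
Qed.

(** Continuity relative to the closed interval: trajectories are continuous on [0, oo) only, so at
    time 0 nothing is known from the left. *)
Definition cont_on (a b : R) (f : R -> R) : Prop :=
  forall r, a <= r <= b -> forall eps, 0 < eps -> exists delta, 0 < delta /\
    forall s, a <= s <= b -> Rabs (s - r) < delta -> Rabs (f s - f r) < eps.

(** The lower right Dini derivative at [t] is nonnegative, written without a quotient. Unlike
    differentiability, this kind of condition passes to a minimum of finitely many functions. *)
Definition rdini_nonneg (f : R -> R) (t : R) : Prop :=
  forall eps, 0 < eps -> exists delta, 0 < delta /\
    forall h, 0 < h < delta -> f t - eps * h <= f (t + h).

Lemma cont_on_sub a b a' b' f : a <= a' -> b' <= b -> cont_on a b f -> cont_on a' b' f.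
Proof.
  intros Ha Hb H r Hr eps Heps. destruct (H r ltac:(lra) eps Heps) as [d [Hd H']].
  exists d. split; [exact Hd|]. intros s Hs. apply H'. lra.
Qed.

Lemma cont_on_plus a b f g : cont_on a b f -> cont_on a b g -> cont_on a b (fun t => f t + g t).
Proof.
  intros Hf Hg r Hr eps Heps.
  destruct (Hf r Hr (eps / 2)) as [d1 [Hd1 H1]]; [lra|].
  destruct (Hg r Hr (eps / 2)) as [d2 [Hd2 H2]]; [lra|].
  exists (Rmin d1 d2). split; [now apply Rmin_pos|]. intros s Hs Hsr.
  specialize (H1 s Hs (Rlt_le_trans _ _ _ Hsr (Rmin_l _ _))).
  specialize (H2 s Hs (Rlt_le_trans _ _ _ Hsr (Rmin_r _ _))).
  replace (f s + g s - (f r + g r)) with ((f s - f r) + (g s - g r)) by ring.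
  eapply Rle_lt_trans; [apply Rabs_triang|]. lra.
Qed.

Lemma cont_on_scal a b c f : cont_on a b f -> cont_on a b (fun t => c * f t).
Proof.
  intros Hf r Hr eps Heps.
  assert (Hc : 0 < Rabs c + 1) by (pose proof (Rabs_pos c); lra).
  destruct (Hf r Hr (eps / (Rabs c + 1))) as [d [Hd H]].
  { now apply Rdiv_lt_0_compat. }
  exists d. split; [exact Hd|]. intros s Hs Hsr. specialize (H s Hs Hsr).
  replace (c * f s - c * f r) with (c * (f s - f r)) by ring. rewrite Rabs_mult.
  apply Rle_lt_trans with ((Rabs c + 1) * Rabs (f s - f r)).
  - apply Rmult_le_compat_r; [apply Rabs_pos | lra].
  - apply (Rmult_lt_compat_l _ _ _ Hc) in H. replace eps with ((Rabs c + 1) * (eps / (Rabs c + 1))) by (field; lra). exact H.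
Qed.

Lemma cont_on_of_continuity a b f : continuity f -> cont_on a b f.
Proof.
  intros Hf r Hr eps Heps. destruct (Hf r eps Heps) as [d [Hd H]].
  exists d. split; [exact Hd|]. intros s Hs Hsr.
  destruct (Req_dec s r) as [->|Hne]; [rewrite Rminus_diag, Rabs_R0; exact Heps|].
  apply H. split; [split; [exact I | lra] | exact Hsr].
Qed.

Lemma cont_on_const a b c : cont_on a b (fun _ => c).
Proof. apply cont_on_of_continuity, continuity_const. intros ? ?; reflexivity. Qed.

Lemma cont_on_rsum a b m (f : nat -> R -> R) :
  (forall i, (i < m)%nat -> cont_on a b (f i)) -> cont_on a b (fun t => rsum m (fun i => f i t)).
Proof.
  induction m as [|m IH]; intros H; simpl.
  - apply cont_on_const.
  - apply (cont_on_plus a b (fun t => rsum m (fun i => f i t)) (f m)).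
    + apply IH. intros; apply H; lia.
    + apply H; lia.
Qed.

Lemma cont_nonneg_on a b f : 0 <= a -> cont_nonneg f -> cont_on a b f.
Proof.
  intros Ha H r Hr eps Heps. destruct (H r ltac:(lra) eps Heps) as [d [Hd H']].
  exists d. split; [exact Hd|]. intros s Hs. apply H'. lra.
Qed.

(* The level y avoids the countable image of the exceptional times, so the last time at which
   f + eps (t - a) is at least y is not exceptional. *)
Lemma dini_barrier (f : R -> R) (e : nat -> R) a b :
  a <= b -> cont_on a b f ->
  (forall t, a < t < b -> (forall m, t <> e m) -> f t < 0 -> rdini_nonneg f t) ->
  0 <= f a -> 0 <= f b.
Proof.
  intros Hab Hc Hd Hfa. apply Rnot_lt_le. intros Hfb.
  assert (Hlt : a < b) by (destruct Hab as [|<-]; lra).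
  (* With this tilt, [g] agrees with [f] at [a], and [g b = f b / 2] is still negative. *)
  set (ep := - f b / (2 * (b - a))).
  assert (Hep : 0 < ep) by (apply Rdiv_lt_0_compat; lra).
  set (g := fun t => f t + ep * (t - a)).
  assert (Hgb : g b < 0).
  { unfold g, ep. replace (- f b / (2 * (b - a)) * (b - a)) with (- f b / 2) by (field; lra). lra. }
  assert (Hgc : cont_on a b g).
  { apply cont_on_plus; [exact Hc|]. apply cont_on_scal.
    apply (cont_on_plus a b (fun t => t) (fun _ => - a)); [|apply cont_on_const].
    apply cont_on_of_continuity, derivable_continuous, derivable_id. }
  destruct (interval_avoids_sequence (fun m => g (e m)) (g b) 0 Hgb) as [y [Hy Hye]].
  destruct (completeness (fun t => a <= t <= b /\ y <= g t)) as [t [Hub Hlub]].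
  { exists b. intros r [Hr _]. lra. }
  { exists a. split; [lra|]. unfold g. rewrite Rminus_diag. lra. }
  assert (Hta : a <= t).
  { apply Hub. split; [lra|]. unfold g. rewrite Rminus_diag. lra. }
  assert (Htb : t <= b) by (apply Hlub; intros r [Hr _]; lra).
  assert (Hafter : forall s, t < s <= b -> g s < y).
  { intros s Hs. apply Rnot_le_lt. intros Hge. assert (s <= t) by (apply Hub; split; [lra | exact Hge]). lra. }
  assert (Hge : y <= g t).
  { apply Rnot_lt_le. intros Hgt.
    destruct (Hgc t (conj Hta Htb) (y - g t)) as [dl [Hdl Hcl]]; [lra|].
    assert (t <= t - dl); [|lra]. apply Hlub. intros r [Hr Hgr].
    apply Rnot_lt_le. intros Hlt'.
    assert (Hrt : r <= t) by (apply Hub; split; assumption).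
    specialize (Hcl r Hr ltac:(rewrite Rabs_left1; lra)).
    apply Rabs_def2 in Hcl. lra. }
  assert (Htb' : t < b) by (destruct Htb as [|E]; [assumption | rewrite E in Hge; lra]).
  assert (Hle : g t <= y).
  { apply Rnot_lt_le. intros Hgt.
    destruct (Hgc t (conj Hta Htb) (g t - y)) as [dl [Hdl Hcl]]; [lra|].
    set (s := t + Rmin (dl / 2) (b - t)).
    pose proof (Rmin_l (dl / 2) (b - t)). pose proof (Rmin_r (dl / 2) (b - t)).
    assert (0 < Rmin (dl / 2) (b - t)) by (apply Rmin_pos; lra).
    assert (Hs : t < s <= b) by (unfold s; lra).
    specialize (Hcl s ltac:(lra)).
    specialize (Hafter s Hs).
    assert (Hab' : Rabs (s - t) < dl) by (unfold s; rewrite Rabs_right; lra).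
    specialize (Hcl Hab'). apply Rabs_def2 in Hcl. lra. }
  assert (Heq : g t = y) by lra.
  assert (Hta' : a < t).
  { destruct Hta as [|E]; [assumption|]. exfalso. rewrite <- E in Heq. unfold g in Heq.
    rewrite Rminus_diag in Heq. lra. }
  assert (Hft : f t < 0).
  { unfold g in Heq. assert (0 < ep * (t - a)) by (apply Rmult_lt_0_compat; lra). lra. }
  (* Just after [t], [f] loses at most [ep / 2] per unit of time while the tilt gains [ep], so [g]
     rises above [y], contrary to [Hafter]. *)
  destruct (Hd t (conj Hta' Htb')) with (eps := ep / 2) as [dl [Hdl Hcl]].
  { intros m E. apply (Hye m). rewrite <- E. symmetry. exact Heq. }
  { exact Hft. } { lra. }
  set (h := Rmin (dl / 2) (b - t)).
  pose proof (Rmin_l (dl / 2) (b - t)). pose proof (Rmin_r (dl / 2) (b - t)).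
  assert (Hh : 0 < h) by (apply Rmin_pos; lra).
  specialize (Hcl h ltac:(unfold h in *; lra)).
  specialize (Hafter (t + h) ltac:(unfold h in *; lra)).
  unfold g in Hafter, Heq.
  assert (0 < ep * h) by (apply Rmult_lt_0_compat; lra).
  replace (ep * (t + h - a)) with (ep * (t - a) + ep * h) in Hafter by ring. lra.
Qed.

Lemma derivable_rdini f t l : derivable_pt_lim f t l -> 0 <= l -> rdini_nonneg f t.
Proof.
  intros Hf Hl eps Heps. destruct (Hf eps Heps) as [d Hd].
  exists d. split; [apply cond_pos|]. intros h Hh.
  specialize (Hd h ltac:(lra) ltac:(rewrite Rabs_right; lra)).
  apply Rabs_def2 in Hd. destruct Hd as [_ Hd].
  assert (Hq : - eps < (f (t + h) - f t) / h) by lra.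
  apply (Rmult_lt_compat_r h) in Hq; [|lra].
  replace ((f (t + h) - f t) / h * h) with (f (t + h) - f t) in Hq by (field; lra). lra.
Qed.

(** The sign of the derivative is required only where [f] is negative. Applied to a quantity minus
    its barrier, this lets one assume that the quantity is under the barrier. *)
Lemma derivative_barrier (f : R -> R) (e : nat -> R) a b :
  a <= b -> cont_on a b f ->
  (forall t, a < t < b -> (forall m, t <> e m) -> f t < 0 ->
     exists l, derivable_pt_lim f t l /\ 0 <= l) ->
  0 <= f a -> 0 <= f b.
Proof.
  intros Hab Hc Hd. apply (dini_barrier f e a b Hab Hc).
  intros t Ht He Hft. destruct (Hd t Ht He Hft) as [l [Hl Hl0]].
  now apply derivable_rdini with l.
Qed.

Lemma nondecreasing_of_derivative (f : R -> R) (e : nat -> R) a b :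
  a <= b -> cont_on a b f ->
  (forall t, a < t < b -> (forall m, t <> e m) -> exists l, derivable_pt_lim f t l /\ 0 <= l) ->
  f a <= f b.
Proof.
  intros Hab Hc Hd.
  assert (H : 0 <= f b + - f a).
  { apply (derivative_barrier (fun t => f t + - f a) e a b Hab).
    - apply cont_on_plus; [exact Hc | apply cont_on_const].
    - intros t Ht He _. destruct (Hd t Ht He) as [l [Hl Hl0]]. exists (l + 0). split; [|lra].
      apply (derivable_pt_lim_plus f (fun _ => - f a)); [exact Hl | apply derivable_pt_lim_const].
    - lra. }
  lra.
Qed.

(** The base value 0 truncates the minimum: it is at most 0, and negative exactly when some term
    is. *)
Fixpoint rmin_upto (m : nat) (f : nat -> R) : R :=
  match m with O => 0 | S p => Rmin (rmin_upto p f) (f p) end.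

Lemma rmin_upto_le m f i : (i < m)%nat -> rmin_upto m f <= f i.
Proof.
  induction m as [|m IH]; simpl; intros Hi; [lia|].
  destruct (Nat.eq_dec i m) as [->|Hne]; [apply Rmin_r|].
  eapply Rle_trans; [apply Rmin_l | apply IH; lia].
Qed.

Lemma rmin_upto_glb m f r : r <= 0 -> (forall i, (i < m)%nat -> r <= f i) -> r <= rmin_upto m f.
Proof.
  intros Hr. induction m as [|m IH]; simpl; intros H; [lra|].
  apply Rmin_glb; [apply IH; intros; apply H; lia | apply H; lia].
Qed.

Lemma rmin_upto_cont a b m (f : nat -> R -> R) :
  (forall i, (i < m)%nat -> cont_on a b (f i)) ->
  cont_on a b (fun t => rmin_upto m (fun i => f i t)).
Proof.
  induction m as [|m IH]; intros H; simpl; [apply cont_on_const|].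
  intros r Hr eps Heps.
  destruct (IH (fun i Hi => H i ltac:(lia)) r Hr eps Heps) as [d1 [Hd1 H1]].
  destruct (H m ltac:(lia) r Hr eps Heps) as [d2 [Hd2 H2]].
  exists (Rmin d1 d2). split; [now apply Rmin_pos|]. intros s Hs Hsr.
  specialize (H1 s Hs (Rlt_le_trans _ _ _ Hsr (Rmin_l _ _))).
  specialize (H2 s Hs (Rlt_le_trans _ _ _ Hsr (Rmin_r _ _))).
  simpl in H1. apply Rabs_def2 in H1. apply Rabs_def2 in H2. apply Rabs_def1;
  unfold Rmin; repeat destruct (Rle_dec _ _); lra.
Qed.

(** The barrier lemma is applied to the truncated minimum. Where it is negative, terms above it stay
    above for a short time by continuity, so derivatives matter only for the terms that attain
    it. *)
Lemma min_principle m (th : nat -> R -> R) (e : nat -> R) a b :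
  a <= b -> (forall i, (i < m)%nat -> cont_on a b (th i)) ->
  (forall i t, (i < m)%nat -> a < t < b -> (forall q, t <> e q) -> th i t < 0 ->
     (forall j, (j < m)%nat -> th i t <= th j t) ->
     exists l, derivable_pt_lim (th i) t l /\ 0 <= l) ->
  (forall i, (i < m)%nat -> 0 <= th i a) ->
  forall i, (i < m)%nat -> 0 <= th i b.
Proof.
  intros Hab Hc Hd Ha i Hi.
  set (F := fun t => rmin_upto m (fun i => th i t)).
  assert (HF : 0 <= F b).
  { apply (dini_barrier F e a b Hab).
    - now apply rmin_upto_cont.
    - intros t Ht He HFt eps Heps.
      destruct (common_delta m (fun i d => forall h, 0 < h < d -> F t - eps * h <= th i (t + h)))
        as [d [Hd0 Hdl]].
      + intros j d1 d2 H Hd12 h Hh. apply H. lra.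
      + intros j Hj.
        assert (HFj : F t <= th j t) by (apply (rmin_upto_le m (fun i => th i t)); exact Hj).
        destruct (Rle_lt_or_eq_dec _ _ HFj) as [Hlt|Heq].
        * destruct (Hc j Hj t ltac:(lra) (th j t - F t)) as [d1 [Hd1 H1]]; [lra|].
          exists (Rmin d1 (b - t)). split; [apply Rmin_pos; lra|]. intros h Hh.
          pose proof (Rmin_l d1 (b - t)). pose proof (Rmin_r d1 (b - t)).
          specialize (H1 (t + h) ltac:(lra)).
          replace (t + h - t) with h in H1 by ring.
          specialize (H1 ltac:(rewrite Rabs_right; lra)). apply Rabs_def2 in H1.
          assert (0 < eps * h) by (apply Rmult_lt_0_compat; lra). lra.
        * destruct (Hd j t Hj Ht He) as [l [Hl Hl0]].
          { lra. }
          { intros q Hq. rewrite <- Heq. now apply (rmin_upto_le m (fun i => th i t)). }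
          destruct (derivable_rdini _ _ _ Hl Hl0 eps Heps) as [d1 [Hd1 H1]].
          exists d1. split; [exact Hd1|]. intros h Hh. rewrite Heq. now apply H1.
      + exists (Rmin d (- F t / eps)). split.
        { apply Rmin_pos; [exact Hd0 | apply Rdiv_lt_0_compat; lra]. }
        intros h Hh. apply rmin_upto_glb.
        * assert (0 < eps * h) by (apply Rmult_lt_0_compat; lra). lra.
        * intros j Hj. apply Hdl; [exact Hj|].
          pose proof (Rmin_l d (- F t / eps)). lra.
    - apply rmin_upto_glb; [lra | exact Ha]. }
  eapply Rle_trans; [exact HF | apply (rmin_upto_le m (fun i => th i b)); exact Hi].
Qed.

(** * Propagation of positivity along joint paths *)

(* All leaders are placed at the common level R0. *)
Definition pull (n k : nat) (g : digraph) (A B : nat -> nat -> R) (R0 : R) (v : nat -> R)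
  (i : nat) : R :=
  rsum n (fun j => if arcF g j i then A i j * (v j - v i) else 0)
  + rsum k (fun j => if arcL g j i then B i j * (R0 - v i) else 0).

Definition weight_bounds (n k : nat) (A B : nat -> nat -> R) (a_lo a_hi b_lo : R) : Prop :=
  (forall i j, (i < n)%nat -> (j < n)%nat -> a_lo <= A i j <= a_hi) /\
  (forall i j, (i < n)%nat -> (j < k)%nat -> b_lo <= B i j).

(** Only an inequality is available, since the gap of a leader is merely known to be at least [R0].
    The weights are arbitrary functions of time: along a trajectory they are values of [a] and [b],
    and only their bounds will matter. *)
Definition supersolution (n k : nat) (sigma : R -> digraph) (A B : R -> nat -> nat -> R)
  (R0 : R) (e : nat -> R) (t0 t1 : R) (th : nat -> R -> R) : Prop :=
  forall i, (i < n)%nat -> cont_on t0 t1 (th i) /\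
    forall t, t0 < t < t1 -> (forall m, t <> e m) ->
      exists l, derivable_pt_lim (th i) t l /\
        pull n k (sigma t) (A t) (B t) R0 (fun j => th j t) i <= l.

Section Pull.
Variables (n k : nat) (a_lo a_hi b_lo : R).
Hypotheses (Ha : 0 < a_lo) (Hah : a_lo <= a_hi) (Hb : 0 < b_lo).

Section Bounds.
Variables (g : digraph) (A B : nat -> nat -> R) (R0 : R) (v : nat -> R) (i : nat).
Hypotheses (Hw : weight_bounds n k A B a_lo a_hi b_lo) (Hi : (i < n)%nat).

Lemma pull_at_min : v i <= R0 -> (forall j, (j < n)%nat -> v i <= v j) ->
  0 <= pull n k g A B R0 v i.
Proof.
  intros HR Hmin. destruct Hw as [HA HB].
  apply Rplus_le_le_0_compat; apply rsum_nonneg; intros j Hj.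
  - destruct (arcF g j i); [|lra]. specialize (HA i j Hi Hj). specialize (Hmin j Hj).
    apply Rmult_le_pos; lra.
  - destruct (arcL g j i); [|lra]. specialize (HB i j Hi Hj). apply Rmult_le_pos; lra.
Qed.

Hypotheses (Hv : forall j, (j < n)%nat -> 0 <= v j) (HvR : v i <= R0).

(** A follower arc costs at most [a_hi * v i], because [v j] is nonnegative. Adding this amount
    makes every summand nonnegative, so that a single active arc can be singled out of the sum. *)
Lemma followers_term_lower j : (j < n)%nat ->
  0 <= (if arcF g j i then A i j * (v j - v i) else 0) + a_hi * v i.
Proof.
  intros Hj. destruct Hw as [HA _]. specialize (HA i j Hi Hj).
  pose proof (Hv j Hj). pose proof (Hv i Hi). destruct (arcF g j i).
  - replace (A i j * (v j - v i) + a_hi * v i) with (A i j * v j + (a_hi - A i j) * v i) by ring.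
    apply Rplus_le_le_0_compat; apply Rmult_le_pos; lra.
  - assert (0 <= a_hi * v i) by (apply Rmult_le_pos; lra). lra.
Qed.

(** The hypothesis [v i <= R0] fixes the sign, which holds for arbitrarily large [B]. *)
Lemma leaders_term_nonneg j : (j < k)%nat ->
  0 <= (if arcL g j i then B i j * (R0 - v i) else 0).
Proof.
  intros Hj. destruct Hw as [_ HB]. specialize (HB i j Hi Hj).
  destruct (arcL g j i); [|lra]. apply Rmult_le_pos; lra.
Qed.

Lemma pull_shift : pull n k g A B R0 v i =
  rsum n (fun j => (if arcF g j i then A i j * (v j - v i) else 0) + a_hi * v i)
  + rsum k (fun j => if arcL g j i then B i j * (R0 - v i) else 0) - INR n * a_hi * v i.
Proof. unfold pull. rewrite rsum_plus, rsum_const. ring. Qed.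

Lemma pull_ge_decay : - (INR n * a_hi) * v i <= pull n k g A B R0 v i.
Proof.
  rewrite pull_shift.
  pose proof (rsum_nonneg _ _ followers_term_lower).
  pose proof (rsum_nonneg _ _ leaders_term_nonneg). lra.
Qed.

Lemma pull_ge_follower_arc j c : (j < n)%nat -> arcF g j i = true -> c <= v j -> v i <= c ->
  Rmin a_lo b_lo * (c - v i) - INR n * a_hi * v i <= pull n k g A B R0 v i.
Proof.
  intros Hj Harc Hc Hvc. rewrite pull_shift.
  pose proof (rsum_ge_term _ _ j followers_term_lower Hj) as H.
  pose proof (rsum_nonneg _ _ leaders_term_nonneg).
  cbv beta in H. rewrite Harc in H.
  assert (Rmin a_lo b_lo * (c - v i) <= A i j * (v j - v i) + a_hi * v i); [|lra].
  destruct Hw as [HA _]. specialize (HA i j Hi Hj). pose proof (Rmin_l a_lo b_lo).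
  assert (0 < Rmin a_lo b_lo) by now apply Rmin_pos.
  pose proof (Hv i Hi).
  assert (0 <= a_hi * v i) by (apply Rmult_le_pos; lra).
  assert (Rmin a_lo b_lo * (c - v i) <= A i j * (v j - v i)); [|lra].
  apply Rmult_le_compat; lra.
Qed.

Lemma pull_ge_leader_arc j c : (j < k)%nat -> arcL g j i = true -> c <= R0 -> v i <= c ->
  Rmin a_lo b_lo * (c - v i) - INR n * a_hi * v i <= pull n k g A B R0 v i.
Proof.
  intros Hj Harc Hc Hvc. rewrite pull_shift.
  pose proof (rsum_ge_term _ _ j leaders_term_nonneg Hj) as H.
  pose proof (rsum_nonneg _ _ followers_term_lower).
  cbv beta in H. rewrite Harc in H.
  assert (Rmin a_lo b_lo * (c - v i) <= B i j * (R0 - v i)); [|lra].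
  destruct Hw as [_ HB]. specialize (HB i j Hi Hj). pose proof (Rmin_r a_lo b_lo).
  assert (0 < Rmin a_lo b_lo) by now apply Rmin_pos.
  apply Rmult_le_compat; lra.
Qed.

End Bounds.

Variables (sigma : R -> digraph) (A B : R -> nat -> nat -> R) (R0 : R) (e : nat -> R)
  (t0 t1 : R) (th : nat -> R -> R).
Hypotheses (Hw : forall t, weight_bounds n k (A t) (B t) a_lo a_hi b_lo)
  (Hsup : supersolution n k sigma A B R0 e t0 t1 th) (HR : 0 <= R0)
  (Hinit : forall i, (i < n)%nat -> 0 <= th i t0).

Lemma supersolution_nonneg i t : (i < n)%nat -> t0 <= t <= t1 -> 0 <= th i t.
Proof.
  intros Hi Ht. apply (min_principle n th e t0 t); try assumption; try lra.
  - intros j Hj. apply cont_on_sub with t0 t1; [lra | lra | now apply Hsup].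
  - intros j s Hj Hs He Hneg Hmin.
    destruct (proj2 (Hsup j Hj) s ltac:(lra) He) as [l [Hl Hpl]].
    exists l. split; [exact Hl|]. eapply Rle_trans; [|exact Hpl].
    apply pull_at_min; [apply Hw | exact Hj | lra | exact Hmin].
Qed.

(** The barrier is the solution of v' = - n a_hi v with value [c] at time [s]. It never exceeds
    [c <= R0], so wherever [th i] is below it the bound [pull_ge_decay] applies. *)
Lemma supersolution_decay i s t c : (i < n)%nat -> t0 <= s -> s <= t -> t <= t1 ->
  0 <= c <= R0 -> c <= th i s -> c * exp (- (INR n * a_hi) * (t - s)) <= th i t.
Proof.
  intros Hi Hs Hst Ht Hc Hcs. set (a := - (INR n * a_hi)).
  assert (Ha0 : a <= 0).
  { unfold a. assert (0 <= INR n * a_hi) by (apply Rmult_le_pos; [apply pos_INR | lra]). lra. }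
  assert (Hd : forall r, derivable_pt_lim (fun r => (- c) * exp (a * (r - s))) r
                 (- c * (a * exp (a * (r - s))))).
  { intros r. apply is_derive_Reals. auto_derive; [exact I | unfold Rminus; ring]. }
  assert (H : 0 <= th i t + - c * exp (a * (t - s))); [|lra].
  apply (derivative_barrier (fun r => th i r + - c * exp (a * (r - s))) e s t Hst).
  - apply cont_on_plus.
    + apply cont_on_sub with t0 t1; [lra | lra | now apply Hsup].
    + apply cont_on_of_continuity, derivable_continuous. intros r. eexists. apply Hd.
  - intros r Hr He Hneg.
    destruct (proj2 (Hsup i Hi) r ltac:(lra) He) as [l [Hl Hpl]].
    exists (l + - c * (a * exp (a * (r - s)))). split.
    { now apply (derivable_pt_lim_plus (th i) (fun r => - c * exp (a * (r - s)))). }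
    assert (Hexp : exp (a * (r - s)) <= 1).
    { rewrite <- exp_0. assert (Hle : a * (r - s) <= 0) by nra.
      destruct Hle as [Hlt|E]; [left; now apply exp_increasing | rewrite E; lra]. }
    assert (Hcexp : c * exp (a * (r - s)) <= c * 1) by (apply Rmult_le_compat_l; lra).
    assert (Hp := pull_ge_decay (sigma r) (A r) (B r) R0 (fun j => th j r) i (Hw r) Hi
      (fun j Hj => supersolution_nonneg j r Hj ltac:(lra)) ltac:(cbv beta; lra)).
    fold a in Hp. cbv beta in Hp.
    assert (a * (c * exp (a * (r - s))) <= a * th i r) by (apply Rmult_le_compat_neg_l; lra).
    lra.
  - rewrite Rminus_diag, Rmult_0_r, exp_0. lra.
Qed.

(** The barrier is the line of slope [c * sl] starting from 0. Below it, [th i] is at most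
    [c * sl * tau], and [sl] is chosen so that at this height the lower bound kap (c - v) - a v for
    the drift equals the slope [c * sl]. *)
Lemma supersolution_gain i s tau c  :
  (i < n)%nat -> 0 < tau -> t0 <= s -> s + tau <= t1 -> 0 <= c <= R0 ->
  (forall t, s < t < s + tau ->
     (exists j, (j < n)%nat /\ arcF (sigma t) j i = true /\ c <= th j t) \/
     (exists j, (j < k)%nat /\ arcL (sigma t) j i = true)) ->
  c * (Rmin a_lo b_lo * tau / (1 + (INR n * a_hi + Rmin a_lo b_lo) * tau)) <= th i (s + tau).
Proof.
  intros Hi Htau Hs Ht Hc Hsrc.
  set (kap := Rmin a_lo b_lo) in *. set (a := INR n * a_hi) in *.
  assert (Hkap : 0 < kap) by now apply Rmin_pos.
  assert (Ha0 : 0 <= a) by (apply Rmult_le_pos; [apply pos_INR | lra]).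
  assert (Hden : 0 < 1 + (a + kap) * tau).
  { assert (0 < (a + kap) * tau) by (apply Rmult_lt_0_compat; lra). lra. }
  set (sl := kap / (1 + (a + kap) * tau)).
  assert (Hsl : 0 < sl) by now apply Rdiv_lt_0_compat.
  assert (Hsleq : sl * (1 + (a + kap) * tau) = kap) by (unfold sl; field; lra).
  assert (H : 0 <= th i (s + tau) + - (c * sl) * (s + tau - s)).
  2:{ replace (kap * tau / (1 + (a + kap) * tau)) with (sl * tau) by (unfold sl; field; lra). lra. }
  apply (derivative_barrier (fun r => th i r + - (c * sl) * (r - s)) e s (s + tau)); [lra| | |].
  - apply cont_on_plus; [apply cont_on_sub with t0 t1; [lra | lra | now apply Hsup]|].
    apply cont_on_of_continuity. apply derivable_continuous. reg.
  - intros r Hr He Hneg.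
    destruct (proj2 (Hsup i Hi) r ltac:(lra) He) as [l [Hl Hpl]].
    exists (l + - (c * sl) * (1 - 0)). split.
    { apply (derivable_pt_lim_plus (th i) (fun r => - (c * sl) * (r - s))); [exact Hl|].
      apply (derivable_pt_lim_scal (fun r => r - s)).
      apply (derivable_pt_lim_minus (fun r => r) (fun _ => s));
        [apply derivable_pt_lim_id | apply derivable_pt_lim_const]. }
    assert (Hcsl : 0 <= c * sl) by (apply Rmult_le_pos; lra).
    assert (Hth : th i r <= c * sl * tau).
    { assert (c * sl * (r - s) <= c * sl * tau) by (apply Rmult_le_compat_l; lra). lra. }
    assert (Hslt : sl * tau <= 1).
    { assert (Hk : sl * tau * kap <= kap).
      { rewrite <- Hsleq at 2. assert (0 <= sl * tau * a) by (apply Rmult_le_pos; [apply Rmult_le_pos|]; lra). nra. }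
      apply Rmult_le_reg_r with kap; lra. }
    assert (Hthc : th i r <= c).
    { assert (c * (sl * tau) <= c * 1) by (apply Rmult_le_compat_l; lra). lra. }
    assert (Hp : kap * (c - th i r) - a * th i r <= l).
    { eapply Rle_trans; [|exact Hpl].
      pose proof (fun j (Hj : (j < n)%nat) => supersolution_nonneg j r Hj ltac:(lra)) as Hnn.
      destruct (Hsrc r Hr) as [[j [Hj [Harc Hcj]]]|[j [Hj Harc]]].
      - now apply (pull_ge_follower_arc (sigma r) (A r) (B r) R0 (fun j => th j r) i (Hw r) Hi Hnn ltac:(cbv beta; lra) j c).
      - apply (pull_ge_leader_arc (sigma r) (A r) (B r) R0 (fun j => th j r) i (Hw r) Hi Hnn ltac:(cbv beta; lra) j c); try assumption; lra. }
    assert ((a + kap) * th i r <= (a + kap) * (c * sl * tau)) by (apply Rmult_le_compat_l; lra).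
    assert (c * sl * (1 + (a + kap) * tau) = c * kap) by (rewrite Rmult_assoc, Hsleq; ring).
    lra.
  - rewrite Rminus_diag. pose proof (supersolution_nonneg i s Hi ltac:(lra)). lra.
Qed.

End Pull.

(** Trace a path from a leader to [i] backwards: as [i] lies outside [l], some arc enters the
    complement of [l] from [l] or from a leader. This arc is all that the contraction takes from
    connectivity. *)
Lemma reach_crossing n k (EF EL : nat -> nat -> Prop) (l : list nat) i :
  reach n k EF EL i -> ~ In i l ->
  exists i', (i' < n)%nat /\ ~ In i' l /\
    ((exists j, (j < k)%nat /\ EL j i') \/ (exists j, In j l /\ EF j i')).
Proof.
  induction 1 as [j i Hj Hi He | j i Hr IH Hi He]; intros Hil.
  - exists i. split; [exact Hi|]. split; [exact Hil|]. left. now exists j.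
  - destruct (in_dec Nat.eq_dec j l) as [Hjl|Hjl]; [|now apply IH].
    exists i. split; [exact Hi|]. split; [exact Hil|]. right. now exists j.
Qed.

Lemma dwell_lower (s : nat -> R) tauD : s O = 0 -> (forall m, s m + tauD <= s (S m)) ->
  forall m, INR m * tauD <= s m.
Proof.
  intros H0 Hs. induction m as [|m IH]; [simpl; lra|]. rewrite S_INR. specialize (Hs m). lra.
Qed.

Lemma dwell_index (s : nat -> R) tauD : 0 < tauD -> s O = 0 ->
  (forall m, s m + tauD <= s (S m)) -> forall r, 0 <= r -> exists m, s m <= r < s (S m).
Proof.
  intros Htau H0 Hs r Hr.
  assert (H : forall M, r < s M -> exists m, s m <= r < s (S m)).
  { induction M as [|M IH]; intros HM; [lra|].
    destruct (Rlt_le_dec r (s M)) as [Hlt|Hle]; [now apply IH | now exists M]. }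
  destruct (INR_unbounded (r / tauD)) as [M HM]. apply (H M).
  pose proof (dwell_lower s tauD H0 Hs M).
  apply (Rmult_lt_compat_r tauD) in HM; [|exact Htau].
  replace (r / tauD * tauD) with r in HM by (field; lra). lra.
Qed.

(** The constancy interval around [r] has length at least [tauD], so at least half of a dwell time
    remains on one side of [r]. An arc seen at one instant is therefore active for that long. *)
Lemma dwell_subinterval sigma tauD : 0 < tauD -> dwell_time sigma tauD ->
  forall r, 0 <= r -> exists s, r - tauD / 2 <= s <= r /\
    forall t, s <= t < s + tauD / 2 -> sigma t = sigma r.
Proof.
  intros Htau (s & H0 & Hs & Hc) r Hr.
  destruct (dwell_index s tauD Htau H0 Hs r Hr) as [m Hm]. specialize (Hs m).
  destruct (Rle_lt_dec (r + tauD / 2) (s (S m))) as [Hle|Hgt].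
  - exists r. split; [lra|]. intros t Ht. rewrite (Hc m t), (Hc m r) by lra. reflexivity.
  - exists (r - tauD / 2). split; [lra|]. intros t Ht.
    rewrite (Hc m t), (Hc m r) by lra. reflexivity.
Qed.

(** [T1] and [mu] are chosen before the weights, the level, the exceptional times and the starting
    time, hence serve all trajectories and all directions at once. *)
Lemma joint_contraction n k sigma tauD a_lo a_hi b_lo :
  0 < tauD -> dwell_time sigma tauD -> 0 < a_lo -> a_lo <= a_hi -> 0 < b_lo ->
  UJLC n k sigma ->
  exists T1 mu, 0 < T1 /\ 0 < mu < 1 /\
    forall A B R0 e t0 th, 0 <= t0 -> 0 <= R0 ->
      (forall t, weight_bounds n k (A t) (B t) a_lo a_hi b_lo) ->
      supersolution n k sigma A B R0 e t0 (t0 + T1) th ->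
      (forall i, (i < n)%nat -> 0 <= th i t0) ->
      forall i, (i < n)%nat -> mu * R0 <= th i (t0 + T1).
Proof.
  intros HtauD Hdwell Ha Hah Hb [T [HT HU]].
  set (tau := tauD / 2). assert (Htau : 0 < tau) by (unfold tau; lra).
  (* An active interval of length [tau] around an instant of the joint window may reach [tau] beyond
     it on either side; both margins belong to [W]. *)
  set (W := T + 2 * tau). assert (HW : 0 < W) by (unfold W; lra).
  set (a := INR n * a_hi).
  assert (Ha0 : 0 <= a) by (apply Rmult_le_pos; [apply pos_INR | lra]).
  set (kap := Rmin a_lo b_lo). assert (Hkap : 0 < kap) by now apply Rmin_pos.
  set (gn := kap * tau / (1 + (a + kap) * tau)).
  assert (Hkt : 0 < kap * tau) by now apply Rmult_lt_0_compat.
  assert (Hat : 0 <= a * tau) by (apply Rmult_le_pos; lra).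
  assert (Hgn : 0 < gn < 1).
  { unfold gn. split; [apply Rdiv_lt_0_compat; nra|].
    apply Rmult_lt_reg_r with (1 + (a + kap) * tau); [nra|].
    replace (kap * tau / (1 + (a + kap) * tau) * (1 + (a + kap) * tau)) with (kap * tau)
      by (field; nra). nra. }
  set (dc := exp (- a * W)).
  assert (Hdc : 0 < dc <= 1).
  { split; [apply exp_pos|]. unfold dc. rewrite <- exp_0.
    assert (0 <= a * W) by (apply Rmult_le_pos; lra).
    destruct (Req_dec (- a * W) 0) as [->|]; [lra|]. left. apply exp_increasing. lra. }
  (* Loss per window: decay of the source until its arc becomes active, gain along the arc, decay of
     the new follower until the window ends. *)
  set (nu := gn * dc * dc).
  assert (Hdc2 : 0 < dc * dc <= 1) by nra.
  assert (Hnu : 0 < nu < 1).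
  { unfold nu. rewrite Rmult_assoc. nra. }
  assert (Hnud : nu <= dc) by (unfold nu; nra).
  (* [n] windows reach all followers. One more, which costs a further factor [nu], makes [T1]
     positive and [mu] less than 1 for every [n], 0 included. *)
  exists (INR (S n) * W), (nu ^ (S n)).
  assert (Hn0 : 0 < INR (S n)) by (apply lt_0_INR; lia).
  split; [now apply Rmult_lt_0_compat|].
  split; [split; [apply pow_lt; lra|]|].
  { apply pow_lt_1_compat; [lra | lia]. }
  intros A B R0 e t0 th Ht0 HR Hw Hsup Hinit.
  set (t1 := t0 + INR (S n) * W) in *.
  assert (Hdecay : forall i s t c, (i < n)%nat -> t0 <= s -> s <= t -> t <= t1 -> t - s <= W ->
     0 <= c <= R0 -> c <= th i s -> c * dc <= th i t).
  { intros i s t c Hi Hs Hst Ht HtW Hc Hcs. eapply Rle_trans;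
      [|apply (supersolution_decay n k a_lo a_hi b_lo Ha Hah Hb sigma A B R0 e t0 t1 th Hw Hsup HR Hinit i s t c Hi Hs Hst Ht Hc Hcs)].
    apply Rmult_le_compat_l; [lra|]. unfold dc. fold a.
    assert (Hle : - a * W <= - a * (t - s)) by nra.
    destruct Hle as [Hlt|E]; [left; now apply exp_increasing | rewrite E; lra]. }
  assert (Hstep : forall s c l, t0 <= s -> s + W <= t1 -> 0 <= c <= R0 ->
     (forall i, In i l -> (i < n)%nat /\ c <= th i s) ->
     (exists i, (i < n)%nat /\ ~ In i l) ->
     exists i, (i < n)%nat /\ ~ In i l /\ c * nu <= th i (s + W)).
  { intros s c l Hs Hs1 Hc Hl [i0 [Hi0 Hi0l]].
    assert (Hs0 : 0 <= s + tau) by lra.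
    destruct (reach_crossing _ _ _ _ l i0 (HU (s + tau) Hs0 i0 Hi0) Hi0l) as [i [Hi [Hil Harc]]].
    exists i. split; [exact Hi|]. split; [exact Hil|].
    assert (Hr : exists r, s + tau <= r < s + tau + T /\
      ((exists j, (j < k)%nat /\ arcL (sigma r) j i = true) \/
       (exists j, In j l /\ arcF (sigma r) j i = true))).
    { destruct Harc as [[j [Hj [r [Hr E]]]]|[j [Hj [r [Hr E]]]]]; exists r; split; try exact Hr.
      - left. now exists j.
      - right. now exists j. }
    destruct Hr as [r [Hr Hact]].
    destruct (dwell_subinterval sigma tauD HtauD Hdwell r ltac:(lra)) as [q [Hq Hconst]].
    fold tau in Hq, Hconst. unfold W in *.
    assert (Hg : c * dc * gn <= th i (q + tau)).
    { apply (supersolution_gain n k a_lo a_hi b_lo Ha Hah Hb sigma A B R0 e t0 t1 th Hw Hsup HR Hinit i q tau (c * dc)); try assumption; try lra.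
      - split; [apply Rmult_le_pos; lra | nra].
      - intros t Ht. rewrite Hconst by lra.
        destruct Hact as [Hact|[j [Hj Harcj]]]; [now right|]. left.
        destruct (Hl j Hj) as [Hjn Hcj]. exists j. split; [exact Hjn|]. split; [exact Harcj|].
        apply (Hdecay j s t c); try assumption; lra. }
    replace (c * nu) with (c * dc * gn * dc) by (unfold nu; ring).
    apply (Hdecay i (q + tau)); try assumption; try lra.
    split; [apply Rmult_le_pos; [apply Rmult_le_pos|]; lra|].
    assert (c * dc <= c * 1) by (apply Rmult_le_compat_l; lra).
    assert (0 <= c * dc) by (apply Rmult_le_pos; lra).
    assert (c * dc * gn <= c * dc * 1) by (apply Rmult_le_compat_l; lra). lra. }
  assert (Hsn : INR (S n) = INR n + 1) by apply S_INR.
  (* Each window adds a follower to the list of those at level R0 * nu ^ q. *)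
  assert (Hind : forall q, (q <= n)%nat -> exists l, NoDup l /\ length l = q /\
     forall i, In i l -> (i < n)%nat /\ R0 * nu ^ q <= th i (t0 + INR q * W)).
  { induction q as [|q IH]; intros Hq.
    - exists nil. split; [constructor|]. split; [reflexivity|]. intros i [].
    - destruct IH as [l [Hnd [Hlen Hl]]]; [lia|].
      set (s := t0 + INR q * W). set (c := R0 * nu ^ q).
      assert (Hp : 0 < nu ^ q <= 1).
      { split; [apply pow_lt; lra|]. rewrite <- (pow1 q). apply pow_incr. lra. }
      assert (Hc : 0 <= c <= R0) by (unfold c; nra).
      assert (Hqn : INR q + 1 <= INR n) by (rewrite <- S_INR; apply le_INR; lia).
      assert (Hq0 : 0 <= INR q * W) by (apply Rmult_le_pos; [apply pos_INR | lra]).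
      assert (Hqn' : (INR q + 1) * W <= INR (S n) * W) by (apply Rmult_le_compat_r; lra).
      assert (Hex : exists i, (i < n)%nat /\ ~ In i l).
      { apply NNPP. intros Hno.
        assert (Hincl : incl (List.seq 0 n) l).
        { intros i Hi. apply in_seq in Hi. apply NNPP. intros Hil. apply Hno. exists i. split; [lia | exact Hil]. }
        apply NoDup_incl_length in Hincl; [|apply seq_NoDup]. rewrite length_seq in Hincl. lia. }
      destruct (Hstep s c l ltac:(unfold s; lra) ltac:(unfold s, t1; lra) Hc Hl Hex) as [i [Hi [Hil Hci]]].
      replace (t0 + INR (S q) * W) with (s + W) by (rewrite S_INR; unfold s; ring).
      replace (R0 * nu ^ S q) with (c * nu) by (unfold c; simpl; ring).
      exists (i :: l). split; [now constructor|]. split; [simpl; lia|].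
      intros j [<-|Hj]; [now split|]. destruct (Hl j Hj) as [Hjn Hcj]. split; [exact Hjn|].
      apply Rle_trans with (c * dc); [apply Rmult_le_compat_l; lra|].
      apply (Hdecay j s); try assumption; unfold s, t1; lra. }
  destruct (Hind n (le_n n)) as [l [Hnd [Hlen Hl]]].
  intros i Hi.
  assert (Hil : In i l).
  { assert (Hincl : incl (List.seq 0 n) l).
    { apply NoDup_length_incl; [exact Hnd | rewrite length_seq; lia|].
      intros j Hj. apply in_seq. destruct (Hl j Hj). lia. }
    apply Hincl, in_seq. lia. }
  destruct (Hl i Hil) as [_ Hci].
  assert (Hp : 0 < nu ^ n <= 1).
  { split; [apply pow_lt; lra|]. rewrite <- (pow1 n). apply pow_incr. lra. }
  replace (nu ^ S n * R0) with (R0 * nu ^ n * nu) by (simpl; ring).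
  apply Rle_trans with (R0 * nu ^ n * dc).
  { apply Rmult_le_compat_l; [apply Rmult_le_pos; lra | lra]. }
  assert (0 <= INR n * W) by (apply Rmult_le_pos; [apply pos_INR | lra]).
  assert (Ht1 : t1 = t0 + INR n * W + W) by (unfold t1; rewrite Hsn; ring).
  apply (Hdecay i (t0 + INR n * W)); try assumption; try lra.
  split; [apply Rmult_le_pos; lra | nra].
Qed.

(** * Support functions and the distance to the hull of the leaders *)

Definition dot (d : nat) (p v : nat -> R) : R := rsum d (fun c => p c * v c).

Definition unit_vec (d : nat) (p : nat -> R) : Prop := rsum d (fun c => p c ^ 2) = 1.

Lemma dot_minus d p v w : dot d p (fun c => v c - w c) = dot d p v - dot d p w.
Proof.
  unfold dot. rewrite <- rsum_minus. apply rsum_ext. intros. ring.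
Qed.

Lemma dot_scal d p a v : dot d p (fun c => a * v c) = a * dot d p v.
Proof. unfold dot. rewrite <- rsum_scal. apply rsum_ext. intros. ring. Qed.

Lemma dot_rsum d p m (v : nat -> nat -> R) :
  dot d p (fun c => rsum m (fun j => v j c)) = rsum m (fun j => dot d p (v j)).
Proof.
  unfold dot. rewrite rsum_swap. apply rsum_ext. intros c _. now rewrite rsum_scal.
Qed.

Lemma sum_sq_nonneg d (v : nat -> R) : 0 <= rsum d (fun c => v c ^ 2).
Proof. apply rsum_nonneg. intros. apply pow2_ge_0. Qed.

Lemma vnorm_sq d v : vnorm d v ^ 2 = rsum d (fun c => v c ^ 2).
Proof. unfold vnorm. apply pow2_sqrt, sum_sq_nonneg. Qed.

Lemma vnorm_nonneg d v : 0 <= vnorm d v.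
Proof. apply sqrt_pos. Qed.

(** Cauchy-Schwarz for a unit vector, read off 0 <= |D p - v|^2 = |v|^2 - D^2 with D = p.v. *)
Lemma unit_dot_le d p v : unit_vec d p -> Rabs (dot d p v) <= vnorm d v.
Proof.
  intros Hp. set (D := dot d p v).
  assert (H : 0 <= rsum d (fun c => (D * p c - v c) ^ 2)) by apply (sum_sq_nonneg d (fun c => D * p c - v c)).
  rewrite (rsum_ext d _ (fun c => (D ^ 2 * p c ^ 2 + v c ^ 2) - (2 * D) * (p c * v c))) in H
    by (intros; ring).
  rewrite rsum_minus, rsum_plus, !rsum_scal in H. unfold unit_vec in Hp.
  change (rsum d (fun c => p c * v c)) with D in H. rewrite Hp, <- vnorm_sq in H.
  apply Rsqr_incr_0; try apply vnorm_nonneg; try apply Rabs_pos.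
  unfold Rsqr. rewrite <- Rabs_mult, Rabs_right; nra.
Qed.

Lemma is_inf_inf_of (S : R -> Prop) b : (exists s, S s) -> (forall s, S s -> b <= s) ->
  is_inf S (inf_of S).
Proof.
  intros [s0 Hs0] Hb. unfold inf_of. apply epsilon_spec.
  destruct (completeness (fun r => forall s, S s -> r <= s)) as [r [Hub Hlub]].
  - exists s0. intros r Hr. now apply Hr.
  - now exists b.
  - exists r. split.
    + intros s Hs. apply Hlub. intros q Hq. now apply Hq.
    + intros q Hq. now apply Hub.
Qed.

Lemma is_lub_sup_of (S : R -> Prop) : (exists s, S s) -> (exists M, forall s, S s -> s <= M) ->
  is_lub S (sup_of S).
Proof.
  intros Hne [M HM]. unfold sup_of. apply epsilon_spec.
  destruct (completeness S) as [r Hr]; [exists M; exact HM | exact Hne | now exists r].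
Qed.

Section Hull.
Variables (k d : nat) (y : nat -> nat -> R).

Lemma rsum_indicator m (j : nat) (f : nat -> R) : (j < m)%nat ->
  rsum m (fun i => (if Nat.eq_dec i j then 1 else 0) * f i) = f j.
Proof.
  induction m as [|m IH]; intros Hj; [lia|]. simpl.
  destruct (Nat.eq_dec m j) as [->|Hne].
  - rewrite rsum_0; [ring|]. intros i Hi. destruct (Nat.eq_dec i j); [lia | ring].
  - rewrite IH by lia. ring.
Qed.

Lemma in_hull_vertex j : (j < k)%nat -> in_hull k d y (y j).
Proof.
  intros Hj. exists (fun i => if Nat.eq_dec i j then 1 else 0). split; [|split].
  - intros i _. destruct (Nat.eq_dec i j); lra.
  - transitivity (rsum k (fun i => (if Nat.eq_dec i j then 1 else 0) * 1)).
    + apply rsum_ext. intros. ring.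
    + apply (rsum_indicator k j (fun _ => 1) Hj).
  - intros c _. symmetry. apply (rsum_indicator k j (fun i => y i c) Hj).
Qed.

Lemma in_hull_segment p q s : 0 <= s <= 1 -> in_hull k d y p -> in_hull k d y q ->
  in_hull k d y (fun c => p c + s * (q c - p c)).
Proof.
  intros Hs (lp & Hlp & Hlp1 & Hp) (lq & Hlq & Hlq1 & Hq).
  exists (fun j => (1 - s) * lp j + s * lq j). split; [|split].
  - intros j Hj. specialize (Hlp j Hj). specialize (Hlq j Hj).
    apply Rplus_le_le_0_compat; apply Rmult_le_pos; lra.
  - rewrite rsum_plus, !rsum_scal, Hlp1, Hlq1. ring.
  - intros c Hc. rewrite (Hp c Hc), (Hq c Hc).
    rewrite (rsum_ext k (fun j => ((1 - s) * lp j + s * lq j) * y j c)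
      (fun j => (1 - s) * (lp j * y j c) + s * (lq j * y j c))) by (intros; ring).
    rewrite rsum_plus, !rsum_scal. ring.
Qed.

Lemma hull_dist_is_inf v : (1 <= k)%nat ->
  is_inf (fun s => exists p, in_hull k d y p /\ s = vnorm d (fun c => v c - p c))
    (hull_dist k d y v).
Proof.
  intros Hk. apply is_inf_inf_of with 0.
  - eexists. exists (y 0%nat). split; [apply in_hull_vertex; lia | reflexivity].
  - intros s (p & _ & ->). apply vnorm_nonneg.
Qed.

(** A half-space that contains the vertices contains the hull, and a unit functional is
    1-Lipschitz. *)
Lemma dot_le_hull_dist p v m : (1 <= k)%nat -> unit_vec d p ->
  (forall j, (j < k)%nat -> dot d p (y j) <= m) -> dot d p v <= m + hull_dist k d y v.
Proof.
  intros Hk Hp Hm. assert (dot d p v - m <= hull_dist k d y v); [|lra].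
  apply (hull_dist_is_inf v Hk). intros s (q & (lam & Hlam & Hlam1 & Hq) & ->).
  pose proof (Rle_abs (dot d p (fun c => v c - q c))) as H.
  pose proof (unit_dot_le d p (fun c => v c - q c) Hp). rewrite dot_minus in *.
  assert (dot d p q <= m); [|lra].
  replace (dot d p q) with (rsum k (fun j => lam j * dot d p (y j))).
  - replace m with (rsum k (fun j => lam j * m)).
    + apply rsum_le. intros j Hj. apply Rmult_le_compat_l; [now apply Hlam | now apply Hm].
    + rewrite (rsum_ext k _ (fun j => m * lam j)) by (intros; ring). rewrite rsum_scal, Hlam1. ring.
  - transitivity (dot d p (fun c => rsum k (fun j => lam j * y j c))).
    + rewrite dot_rsum. apply rsum_ext. intros j _. symmetry. apply dot_scal.
    + apply rsum_ext. intros c Hc. now rewrite Hq.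
Qed.

(** Any bound uniform in [q] will do: it controls the quadratic term when a hull point is moved
    towards a vertex. Here both points have coordinates of size at most [Y c]. *)
Lemma hull_bounded : exists K, 0 < K /\ forall q j, in_hull k d y q -> (j < k)%nat ->
  rsum d (fun c => (y j c - q c) ^ 2) <= K.
Proof.
  set (Y := fun c => rsum k (fun j => Rabs (y j c))).
  exists (1 + rsum d (fun c => (2 * Y c) ^ 2)). split.
  - pose proof (sum_sq_nonneg d (fun c => 2 * Y c)). cbv beta in H. lra.
  - intros q j (lam & Hlam & Hlam1 & Hq) Hj.
    assert (rsum d (fun c => (y j c - q c) ^ 2) <= rsum d (fun c => (2 * Y c) ^ 2)); [|lra].
    apply rsum_le. intros c Hc.
    assert (H1 : Rabs (y j c) <= Y c).
    { apply (rsum_ge_term k (fun i => Rabs (y i c))); [intros; apply Rabs_pos | exact Hj]. }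
    assert (H2 : Rabs (q c) <= Y c).
    { rewrite Hq by exact Hc. apply rsum_abs_le. intros i Hi.
      rewrite Rabs_mult, (Rabs_right (lam i)) by (apply Rle_ge; now apply Hlam).
      assert (lam i <= 1) by (rewrite <- Hlam1; now apply rsum_ge_term).
      pose proof (Rabs_pos (y i c)). nra. }
    apply pow_maj_Rabs. eapply Rle_trans; [apply Rabs_triang|]. rewrite Rabs_Ropp. lra.
Qed.

(* If p is the unit direction from an almost nearest hull point q to v and some vertex y j
   violated the bound along p, moving q slightly towards y j would beat the infimum. *)
Lemma hull_dist_le_support v r : (1 <= k)%nat -> 0 <= r ->
  (forall p, unit_vec d p -> exists j, (j < k)%nat /\ dot d p v <= dot d p (y j) + r) ->
  hull_dist k d y v <= r.
Proof.
  intros Hk Hr Hsup. apply Rnot_lt_le. intros Hlt.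
  set (dl := hull_dist k d y v) in *.
  destruct (hull_dist_is_inf v Hk) as [Hlow Hglb]. fold dl in Hlow, Hglb.
  destruct hull_bounded as [K [HK HKb]].
  (* Will bound the inner product [G] of v - q and y_j - q from below: |v - q| is at least [dl], and
     along [p] the vertex lies at least [dl - r] beyond [q]. *)
  set (g := dl * (dl - r)).
  assert (Hg : 0 < g) by (apply Rmult_lt_0_compat; lra).
  (* A step [s] towards the vertex lowers the squared distance by [2 * s * G >= 2 * s * g]; with
     [s * K <= g] the quadratic term gives back at most [s * g]. *)
  set (s := Rmin 1 (g / K)).
  assert (Hs : 0 < s) by (apply Rmin_pos; [lra | now apply Rdiv_lt_0_compat]).
  assert (Hs1 : s <= 1) by apply Rmin_l.
  assert (HsK : s * K <= g).
  { apply Rle_trans with (g / K * K); [apply Rmult_le_compat_r; [lra | apply Rmin_r]|].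
    right. field. lra. }
  assert (Hsg : 0 < s * g) by now apply Rmult_lt_0_compat.
  (* The infimum is only approached. This tolerance keeps the excess of (dl + eta)^2 over dl^2 at
     most [s * g / 2], below the net gain [s * g]. *)
  set (eta := Rmin 1 (s * g / (2 * (2 * dl + 1)))).
  assert (Heta : 0 < eta) by (apply Rmin_pos; [lra | apply Rdiv_lt_0_compat; lra]).
  assert (Heta1 : eta <= 1) by apply Rmin_l.
  assert (Heta2 : eta * (2 * dl + 1) <= s * g / 2).
  { apply Rle_trans with (s * g / (2 * (2 * dl + 1)) * (2 * dl + 1)).
    - apply Rmult_le_compat_r; [lra | apply Rmin_r].
    - right. field. lra. }
  assert (Hq : exists q, in_hull k d y q /\ vnorm d (fun c => v c - q c) < dl + eta).
  { apply NNPP. intros Hno. assert (dl + eta <= dl); [|lra]. apply Hglb.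
    intros t (q & Hq & ->). apply Rnot_lt_le. intros Hn. apply Hno. now exists q. }
  destruct Hq as [q [Hq HN]]. set (N := vnorm d (fun c => v c - q c)) in *.
  assert (HNd : dl <= N) by (apply Hlow; now exists q).
  assert (HN2 : N ^ 2 = rsum d (fun c => (v c - q c) ^ 2)) by apply vnorm_sq.
  set (p := fun c => / N * (v c - q c)).
  assert (Hp : unit_vec d p).
  { unfold unit_vec, p. rewrite (rsum_ext d _ (fun c => (/ N) ^ 2 * (v c - q c) ^ 2)) by (intros; ring).
    rewrite rsum_scal, <- HN2. field. lra. }
  destruct (Hsup p Hp) as [j [Hj Hpj]].
  assert (Hpv : dot d p v - dot d p q = N).
  { rewrite <- dot_minus. unfold dot, p.
    rewrite (rsum_ext d _ (fun c => / N * (v c - q c) ^ 2)) by (intros; ring).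
    rewrite rsum_scal, <- HN2. field. lra. }
  set (G := rsum d (fun c => (v c - q c) * (y j c - q c))).
  assert (HG : G = N * (dot d p (y j) - dot d p q)).
  { rewrite <- dot_minus. unfold dot, p, G. rewrite <- rsum_scal. apply rsum_ext. intros c _.
    field. lra. }
  assert (HGg : g <= G).
  { rewrite HG. unfold g. apply Rmult_le_compat; lra. }
  set (qs := fun c => q c + s * (y j c - q c)).
  assert (Hqs : dl <= vnorm d (fun c => v c - qs c)).
  { apply Hlow. exists qs. split; [|reflexivity].
    apply in_hull_segment; [lra | exact Hq | now apply in_hull_vertex]. }
  assert (Hexp : vnorm d (fun c => v c - qs c) ^ 2 =
    N ^ 2 - 2 * s * G + s ^ 2 * rsum d (fun c => (y j c - q c) ^ 2)).
  { rewrite vnorm_sq, HN2. unfold G. rewrite <- !rsum_scal, <- rsum_minus, <- rsum_plus.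
    apply rsum_ext. intros c _. unfold qs. ring. }
  specialize (HKb q j Hq Hj).
  assert (H1 : dl ^ 2 <= vnorm d (fun c => v c - qs c) ^ 2) by (apply pow_incr; lra).
  assert (H2 : N ^ 2 <= (dl + eta) ^ 2) by (apply pow_incr; lra).
  assert (H3 : s ^ 2 * rsum d (fun c => (y j c - q c) ^ 2) <= s * g).
  { apply Rle_trans with (s ^ 2 * K); [apply Rmult_le_compat_l; [apply pow2_ge_0 | exact HKb]|].
    replace (s ^ 2 * K) with (s * (s * K)) by ring. apply Rmult_le_compat_l; lra. }
  assert (H4 : s * g <= s * G) by (apply Rmult_le_compat_l; lra).
  assert (H5 : eta * eta <= eta * 1) by (apply Rmult_le_compat_l; lra).
  nra.
Qed.

End Hull.

(** * Sufficiency of uniform joint connectivity *)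

Lemma derivable_dot d p (v : R -> nat -> R) t l :
  (forall c, (c < d)%nat -> derivable_pt_lim (fun s => v s c) t (l c)) ->
  derivable_pt_lim (fun s => dot d p (v s)) t (dot d p l).
Proof.
  unfold dot. induction d as [|d IH]; intros H; simpl.
  - apply derivable_pt_lim_const.
  - apply (derivable_pt_lim_plus (fun s => rsum d (fun c => p c * v s c)) (fun s => p d * v s d)).
    + apply IH. intros; apply H; lia.
    + apply (derivable_pt_lim_scal (fun s => v s d)). apply H. lia.
Qed.

Lemma cont_on_dot a b d p (v : R -> nat -> R) :
  (forall c, (c < d)%nat -> cont_on a b (fun s => v s c)) -> cont_on a b (fun s => dot d p (v s)).
Proof.
  intros H. apply (cont_on_rsum a b d (fun c s => p c * v s c)).
  intros c Hc. apply cont_on_scal. now apply H.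
Qed.

Lemma cont_on_affine a b s0 c0 c1 : cont_on a b (fun s => c0 + c1 * (s - s0)).
Proof. apply cont_on_of_continuity, derivable_continuous. reg. Qed.

Lemma derivable_affine s0 c0 c1 t : derivable_pt_lim (fun s => c0 + c1 * (s - s0)) t c1.
Proof. apply is_derive_Reals. auto_derive; [exact I | ring]. Qed.

Section Trajectory.
Variables (n k d : nat) (sigma : R -> digraph) (a b : weight) (a_lo a_hi b_lo : R)
  (u : leader_input) (w : disturbance) (x y : trajectory).
Hypotheses (Hk : (1 <= k)%nat) (Hw : weights_ok n k d a b a_lo a_hi b_lo)
  (Hsol : is_solution n k d sigma a b u w x y) (Hzb : z_bounded n k d u w y).

Let Z := z_supnorm n k d u w y.

Lemma znorm_le_sup t : 0 <= t -> znorm n k d u w y t <= Z.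
Proof.
  intros Ht. apply (is_lub_sup_of (fun s => exists t, 0 <= t /\ s = znorm n k d u w y t)).
  - eexists. exists 0. split; [lra | reflexivity].
  - destruct Hzb as [M HM]. exists M. intros s (q & Hq & ->). now apply HM.
  - now exists t.
Qed.

Lemma z_supnorm_nonneg : 0 <= Z.
Proof. eapply Rle_trans; [apply sqrt_pos | apply (znorm_le_sup 0); lra]. Qed.

Lemma leader_input_le t i : 0 <= t -> (i < k)%nat -> vnorm d (u i (y t) t) <= Z.
Proof.
  intros Ht Hi. eapply Rle_trans; [|apply (znorm_le_sup t Ht)]. apply sqrt_le_1_alt.
  pose proof (rsum_ge_term k (fun i => rsum d (fun c => u i (y t) t c ^ 2)) i
    (fun j _ => sum_sq_nonneg d _) Hi) as H.
  pose proof (rsum_nonneg n (fun i => rsum d (fun c => w i t c ^ 2)) (fun j _ => sum_sq_nonneg d _)).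
  cbv beta in H. lra.
Qed.

Lemma disturbance_le t i : 0 <= t -> (i < n)%nat -> vnorm d (w i t) <= Z.
Proof.
  intros Ht Hi. eapply Rle_trans; [|apply (znorm_le_sup t Ht)]. apply sqrt_le_1_alt.
  pose proof (rsum_ge_term n (fun i => rsum d (fun c => w i t c ^ 2)) i
    (fun j _ => sum_sq_nonneg d _) Hi) as H.
  pose proof (rsum_nonneg k (fun i => rsum d (fun c => u i (y t) t c ^ 2)) (fun j _ => sum_sq_nonneg d _)).
  cbv beta in H. lra.
Qed.

Lemma dot_rhs p t i : dot d p (rhs_x n k sigma a b w (x t) (y t) t i) =
  rsum n (fun j => if arcF (sigma t) j i
                   then a i j (x t) (y t) t * (dot d p (x t j) - dot d p (x t i)) else 0)
  + rsum k (fun j => if arcL (sigma t) j i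
                     then b i j (x t) (y t) t * (dot d p (y t j) - dot d p (x t i)) else 0)
  + dot d p (w i t).
Proof.
  set (F := fun j c => if arcF (sigma t) j i then a i j (x t) (y t) t * (x t j c - x t i c) else 0).
  set (G := fun j c => if arcL (sigma t) j i then b i j (x t) (y t) t * (y t j c - x t i c) else 0).
  transitivity (dot d p (fun c => rsum n (fun j => F j c)) + dot d p (fun c => rsum k (fun j => G j c))
    + dot d p (w i t)).
  - unfold dot. rewrite <- !rsum_plus. apply rsum_ext. intros c _. unfold rhs_x, F, G. ring.
  - rewrite !dot_rsum. f_equal. f_equal; apply rsum_ext; intros j _; unfold F, G;
    destruct (_ (sigma t) j i); rewrite <- ?dot_minus, <- ?dot_scal; try reflexivity;
    unfold dot; apply rsum_0; intros; ring.
Qed.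

Lemma leader_speed p t0 t j : unit_vec d p -> 0 <= t0 <= t -> (j < k)%nat ->
  Rabs (dot d p (y t j) - dot d p (y t0 j)) <= Z * (t - t0).
Proof.
  intros Hp Ht Hj. destruct Hsol as (_ & Hcy & e & He).
  assert (Hc : cont_on t0 t (fun s => dot d p (y s j))).
  { apply cont_on_dot. intros c Hc. apply cont_nonneg_on; [lra | now apply Hcy]. }
  assert (Hd : forall s, t0 < s < t -> (forall m, s <> e m) ->
    exists l, derivable_pt_lim (fun s => dot d p (y s j)) s l /\ Rabs l <= Z).
  { intros s Hs Hse. exists (dot d p (u j (y s) s)). split.
    - apply (derivable_dot d p (fun s => y s j)). intros c Hcd.
      apply (He s ltac:(lra) Hse); assumption.
    - eapply Rle_trans; [now apply unit_dot_le | apply leader_input_le; [lra | exact Hj]]. }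
  apply Rabs_le. split.
  - assert (H : (0 + Z * (t0 - t0)) + dot d p (y t0 j) <= (0 + Z * (t - t0)) + dot d p (y t j)); [|lra].
    apply (nondecreasing_of_derivative (fun s => (0 + Z * (s - t0)) + dot d p (y s j)) e); [lra| |].
    + apply cont_on_plus; [apply cont_on_affine | exact Hc].
    + intros s Hs Hse. destruct (Hd s Hs Hse) as [l [Hl HlZ]]. exists (Z + l). split.
      * apply (derivable_pt_lim_plus (fun s => 0 + Z * (s - t0)) (fun s => dot d p (y s j)));
          [apply derivable_affine | exact Hl].
      * apply Rabs_le_between in HlZ. lra.
  - assert (H : (0 + Z * (t0 - t0)) + -1 * dot d p (y t0 j) <= (0 + Z * (t - t0)) + -1 * dot d p (y t j)); [|lra].
    apply (nondecreasing_of_derivative (fun s => (0 + Z * (s - t0)) + -1 * dot d p (y s j)) e); [lra| |].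
    + apply cont_on_plus; [apply cont_on_affine | apply cont_on_scal, Hc].
    + intros s Hs Hse. destruct (Hd s Hs Hse) as [l [Hl HlZ]]. exists (Z + -1 * l). split.
      * apply (derivable_pt_lim_plus (fun s => 0 + Z * (s - t0)) (fun s => -1 * dot d p (y s j)));
          [apply derivable_affine | now apply (derivable_pt_lim_scal (fun s => dot d p (y s j)))].
      * apply Rabs_le_between in HlZ. lra.
Qed.

(** The bound on supersolutions is a premise so that the argument serves twice: with [q = mu] over a
    full period, and with [q = 0] over any duration. Of the two terms [Z * D], one is the rise of
    the moving level, the other the possible retreat of the leader [j] that was extreme at [t0]. *)
Lemma Ldist_contraction t0 D q : 0 <= t0 -> 0 <= D -> q <= 1 ->
  (forall A B R0 e th, 0 <= R0 ->
     (forall t, weight_bounds n k (A t) (B t) a_lo a_hi b_lo) ->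
     supersolution n k sigma A B R0 e t0 (t0 + D) th ->
     (forall i, (i < n)%nat -> 0 <= th i t0) ->
     forall i, (i < n)%nat -> q * R0 <= th i (t0 + D)) ->
  0 < b_lo ->
  Ldist n k d (x (t0 + D)) (y (t0 + D)) <= (1 - q) * Ldist n k d (x t0) (y t0) + 2 * Z * D.
Proof.
  intros Ht0 HD Hq Hlow Hblo. set (R0 := Ldist n k d (x t0) (y t0)).
  assert (HR : 0 <= R0) by apply rmax_upto_nonneg.
  pose proof z_supnorm_nonneg as HZ.
  assert (HZD : 0 <= 2 * Z * D) by (apply Rmult_le_pos; lra).
  assert (HqR : 0 <= (1 - q) * R0) by (apply Rmult_le_pos; lra).
  apply rmax_upto_lub; [lra|]. intros i Hi. apply hull_dist_le_support; [exact Hk | lra|].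
  intros p Hp.
  destruct (exists_argmax k (fun j => dot d p (y t0 j)) Hk) as [j [Hj Hmax]].
  exists j. split; [exact Hj|]. set (m := dot d p (y t0 j)) in *.
  (* The level rises at speed [Z], hence keeps ahead of every leader by at least [R0], and the same
     [Z] absorbs the disturbance. It cancels in differences between followers. *)
  set (th := fun i t => ((m + R0) + Z * (t - t0)) + -1 * dot d p (x t i)).
  assert (Hth : q * R0 <= th i (t0 + D)).
  { destruct Hsol as (Hcx & _ & e & He).
    apply (Hlow (fun t i j => a i j (x t) (y t) t) (fun t i j => b i j (x t) (y t) t) R0 e th HR).
    - intros t. destruct Hw as [Hwa Hwb].
      split; intros i' j' Hi' Hj'; [now apply Hwa | now apply Hwb].
    - intros i' Hi'. split.
      + apply cont_on_plus; [apply cont_on_affine|]. apply cont_on_scal, cont_on_dot.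
        intros c Hc. apply cont_nonneg_on; [lra | now apply Hcx].
      + intros t Ht Hte.
        exists (Z + -1 * dot d p (rhs_x n k sigma a b w (x t) (y t) t i')). split.
        * apply (derivable_pt_lim_plus (fun s => (m + R0) + Z * (s - t0)) (fun s => -1 * dot d p (x s i')));
            [apply derivable_affine|].
          apply (derivable_pt_lim_scal (fun s => dot d p (x s i'))).
          apply (derivable_dot d p (fun s => x s i')). intros c Hc.
          apply (He t ltac:(lra) Hte); assumption.
        * rewrite dot_rhs. unfold pull.
          assert (HW : dot d p (w i' t) <= Z).
          { eapply Rle_trans; [apply Rle_abs|]. eapply Rle_trans; [now apply unit_dot_le|].
            apply disturbance_le; [lra | exact Hi']. }
          match goal with |- ?F1 + ?L1 <= Z + -1 * (?F2 + ?L2 + _) =>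
            assert (HF : F1 + F2 <= 0); [|assert (HL : L1 + L2 <= 0); [|lra]] end;
          rewrite <- rsum_plus.
          -- right. apply rsum_0. intros j' _. destruct (arcF (sigma t) j' i'); [|ring]. unfold th. ring.
          -- apply Rle_trans with (rsum k (fun _ => 0)); [|right; now apply rsum_0].
             apply rsum_le. intros j' Hj'.
             destruct (arcL (sigma t) j' i'); [|lra]. unfold th.
             assert (Hb' : b_lo <= b i' j' (x t) (y t) t) by now apply Hw.
             pose proof (leader_speed p t0 t j' Hp ltac:(lra) Hj') as Hsp.
             apply Rabs_le_between in Hsp. specialize (Hmax j' Hj').
             rewrite <- Rmult_plus_distr_l.
             assert (0 <= b i' j' (x t) (y t) t * (m + Z * (t - t0) - dot d p (y t j'))); [|lra].
             apply Rmult_le_pos; lra.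
    - intros i' Hi'. unfold th. rewrite Rminus_diag.
      pose proof (dot_le_hull_dist k d (y t0) p (x t0 i') m Hk Hp Hmax).
      assert (hull_dist k d (y t0) (x t0 i') <= R0)
        by (apply (rmax_upto_ge n (fun i => hull_dist k d (y t0) (x t0 i))); exact Hi').
      lra.
    - exact Hi. }
  unfold th in Hth.
  pose proof (leader_speed p t0 (t0 + D) j Hp ltac:(lra) Hj) as Hsp.
  apply Rabs_le_between in Hsp. replace (t0 + D - t0) with D in * by ring. fold m in Hsp. lra.
Qed.

End Trajectory.

(** * Comparison functions and the resulting estimate *)

Lemma classKL_exp C c : 0 < C -> 0 < c -> classKL (fun r t => r * (C * exp (- c * t))).
Proof.
  intros HC Hc. split.
  - intros t Ht. set (q := C * exp (- c * t)).
    assert (Hq : 0 < q) by (apply Rmult_lt_0_compat; [lra | apply exp_pos]).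
    split; [|split; [ring|]].
    + intros r _ eps Heps. exists (eps / q). split; [now apply Rdiv_lt_0_compat|].
      intros s _ Hs. replace (s * q - r * q) with ((s - r) * q) by ring.
      rewrite Rabs_mult, (Rabs_right q) by lra.
      apply (Rmult_lt_compat_r q) in Hs; [|exact Hq]. replace (eps / q * q) with eps in Hs by (field; lra). exact Hs.
    + intros r s _ Hrs. apply Rmult_lt_compat_r; lra.
  - intros r Hr. split.
    + intros t1 t2 Ht1 Ht. apply Rmult_le_compat_l; [exact Hr|]. apply Rmult_le_compat_l; [lra|].
      destruct Ht as [Ht | ->]; [left; apply exp_increasing; nra | lra].
    (* Since exp (c t) exceeds c t, it is enough that c t be at least r C / eps. *)
    + intros eps Heps. exists (r * C / eps / c). intros t Ht.
      assert (Hct : r * C / eps <= c * t).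
      { apply (Rmult_le_compat_l c) in Ht; [|lra]. replace (c * (r * C / eps / c)) with (r * C / eps) in Ht by (field; lra). exact Ht. }
      assert (HrC : 0 <= r * C) by (apply Rmult_le_pos; lra).
      assert (Hexp : 1 + c * t <= exp (c * t)) by apply exp_ineq1_le.
      rewrite Rabs_right.
      2:{ apply Rle_ge, Rmult_le_pos; [lra|]. apply Rmult_le_pos; [lra | left; apply exp_pos]. }
      replace (- c * t) with (- (c * t)) by ring. rewrite exp_Ropp.
      pose proof (exp_pos (c * t)).
      apply Rmult_lt_reg_r with (exp (c * t)); [assumption|].
      replace (r * (C * / exp (c * t)) * exp (c * t)) with (r * C) by (field; lra).
      assert (r * C <= eps * (c * t)).
      { apply (Rmult_le_compat_l eps) in Hct; [|lra]. replace (eps * (r * C / eps)) with (r * C) in Hct by (field; lra). exact Hct. }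
      assert (eps * (1 + c * t) <= eps * exp (c * t)) by (apply Rmult_le_compat_l; lra). lra.
Qed.

Lemma classK_linear C : 0 < C -> classK (fun r => C * r).
Proof.
  intros HC. split; [|split; [ring|]].
  - intros r _ eps Heps. exists (eps / C). split; [now apply Rdiv_lt_0_compat|].
    intros s _ Hs. rewrite <- Rmult_minus_distr_l, Rabs_mult, (Rabs_right C) by lra.
    apply (Rmult_lt_compat_l C) in Hs; [|exact HC]. replace (C * (eps / C)) with eps in Hs by (field; lra). exact Hs.
  - intros r s _ Hrs. now apply Rmult_lt_compat_l.
Qed.

Lemma UJLC_SISS n k d sigma tauD a b a_lo a_hi b_lo : (1 <= k)%nat -> 0 < tauD ->
  dwell_time sigma tauD -> 0 < a_lo -> a_lo <= a_hi -> 0 < b_lo ->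
  weights_ok n k d a b a_lo a_hi b_lo -> UJLC n k sigma -> SISS n k d sigma a b.
Proof.
  intros Hk HtauD Hdwell Ha Hah Hb Hw HU.
  destruct (joint_contraction n k sigma tauD a_lo a_hi b_lo HtauD Hdwell Ha Hah Hb HU)
    as (T1 & mu & HT1 & Hmu & Hcontr).
  (* Chosen so that exp (- c T1) = 1 - mu. *)
  set (c := - ln (1 - mu) / T1).
  assert (Hln : ln (1 - mu) < 0) by (rewrite <- ln_1; apply ln_increasing; lra).
  assert (Hc : 0 < c) by (apply Rdiv_lt_0_compat; lra).
  (* The factor [/ (1 - mu)] pays for rounding [t / T1] down. [2 * T1 / mu] is the fixed point of
     the recursion g = (1 - mu) g + 2 T1, and the further [2 * T1] covers the incomplete last
     period. *)
  exists (fun r t => r * (/ (1 - mu) * exp (- c * t))), (fun r => (2 * T1 / mu + 2 * T1) * r).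
  assert (Hg : 0 < 2 * T1 / mu) by (apply Rdiv_lt_0_compat; lra).
  split; [apply classKL_exp; [apply Rinv_0_lt_compat; lra | exact Hc]|].
  split; [apply classK_linear; lra|].
  intros u w x y _ _ Hsol Hzb t Ht.
  set (Z := z_supnorm n k d u w y).
  assert (HZ : 0 <= Z) by (apply z_supnorm_nonneg; assumption).
  set (L := fun t => Ldist n k d (x t) (y t)).
  assert (HL : forall s, 0 <= L s) by (intros; apply rmax_upto_nonneg).
  assert (Hgrow : forall t0 D, 0 <= t0 -> 0 <= D -> L (t0 + D) <= L t0 + 2 * Z * D).
  { intros t0 D Ht0 HD.
    replace (L t0) with ((1 - 0) * L t0) by ring.
    apply (Ldist_contraction n k d sigma a b a_lo a_hi b_lo u w x y); try assumption; try lra.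
    intros A B R0 e th HR HAB Hsup Hinit i Hi. rewrite Rmult_0_l.
    apply (supersolution_nonneg n k a_lo a_hi b_lo) with (sigma := sigma) (A := A) (B := B) (R0 := R0) (e := e) (t0 := t0) (t1 := t0 + D); try assumption; lra. }
  assert (Hit : forall q : nat, L (INR q * T1) <= (1 - mu) ^ q * L 0 + 2 * T1 / mu * Z).
  { induction q as [|q IH].
    - simpl. rewrite Rmult_0_l. assert (0 <= 2 * T1 / mu * Z) by (apply Rmult_le_pos; lra). lra.
    - rewrite S_INR. replace ((INR q + 1) * T1) with (INR q * T1 + T1) by ring.
      assert (Hq0 : 0 <= INR q * T1) by (apply Rmult_le_pos; [apply pos_INR | lra]).
      apply Rle_trans with ((1 - mu) * L (INR q * T1) + 2 * Z * T1).
      + apply (Ldist_contraction n k d sigma a b a_lo a_hi b_lo u w x y); try assumption; try lra.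
        intros A B R0 e th HR HAB Hsup Hinit. now apply (Hcontr A B R0 e).
      + apply (Rmult_le_compat_l (1 - mu)) in IH; [|lra]. simpl.
        replace (2 * T1 / mu * Z) with ((1 - mu) * (2 * T1 / mu * Z) + 2 * Z * T1) by (field; lra).
        lra. }
  assert (Hq : exists q : nat, INR q * T1 <= t < INR q * T1 + T1).
  { destruct (dwell_index (fun q => INR q * T1) T1 HT1) with (r := t) as [q Hq].
    - simpl. ring.
    - intros m. rewrite S_INR. lra.
    - exact Ht.
    - exists q. rewrite S_INR in Hq. lra. }
  destruct Hq as [q Hq].
  specialize (Hgrow (INR q * T1) (t - INR q * T1)
    ltac:(apply Rmult_le_pos; [apply pos_INR | lra]) ltac:(lra)).
  replace (INR q * T1 + (t - INR q * T1)) with t in Hgrow by ring.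
  assert (HZt : 2 * Z * (t - INR q * T1) <= 2 * Z * T1) by (apply Rmult_le_compat_l; lra).
  assert (Hpow : (1 - mu) ^ q <= / (1 - mu) * exp (- c * t)).
  { replace (/ (1 - mu)) with (exp (- ln (1 - mu))) by (rewrite exp_Ropp, exp_ln; lra).
    rewrite <- Rpower_pow, <- exp_plus by lra. unfold Rpower.
    assert (Hle : INR q * ln (1 - mu) <= - ln (1 - mu) + - c * t).
    { unfold c. replace (- (- ln (1 - mu) / T1) * t) with (ln (1 - mu) * (t / T1)) by (field; lra).
      assert (t / T1 <= INR q + 1); [|nra].
      apply Rmult_le_reg_r with T1; [lra|]. replace (t / T1 * T1) with t by (field; lra). lra. }
    destruct Hle as [Hlt|E]; [left; now apply exp_increasing | right; f_equal; exact E]. }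
  specialize (Hit q). change (L t <= L 0 * (/ (1 - mu) * exp (- c * t)) + (2 * T1 / mu + 2 * T1) * Z).
  apply (Rmult_le_compat_r (L 0)) in Hpow; [|apply HL]. lra.
Qed.

(** * Compactness of boxes *)

Fixpoint tuple_fun (m : nat) : Compactness.Tn m R -> nat -> R :=
  match m with
  | O => fun _ _ => 0
  | S p => fun v i => match i with O => fst v | S q => tuple_fun p (snd v) q end
  end.

Fixpoint fun_tuple (m : nat) (X : nat -> R) : Compactness.Tn m R :=
  match m with O => tt | S p => (X O, fun_tuple p (fun i => X (S i))) end.

Lemma close_fun_tuple m dl X v : close_n m dl (fun_tuple m X) v ->
  forall i, (i < m)%nat -> Rabs (X i - tuple_fun m v i) < dl.
Proof.
  revert X v. induction m as [|m IH]; intros X v H i Hi; [lia|].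
  destruct v as [v0 v]. destruct H as [H0 H]. destruct i as [|i]; [exact H0|].
  apply (IH (fun i => X (S i)) v H). lia.
Qed.

Lemma bounded_fun_tuple m lo hi X : (forall i, (i < m)%nat -> lo i <= X i <= hi i) ->
  bounded_n m (fun_tuple m lo) (fun_tuple m hi) (fun_tuple m X).
Proof.
  revert lo hi X. induction m as [|m IH]; intros lo hi X H; simpl; [exact I|].
  split; [apply H; lia|]. apply IH. intros i Hi. apply H. lia.
Qed.

(** A Lebesgue number for the cover by boxes of radius [dl c]: each point of the box is near a
    centre whose radius is at least [r], so local properties transfer at a uniform scale. *)
Lemma box_lebesgue m lo hi (dl : (nat -> R) -> R) : (forall c, 0 < dl c) ->
  exists r, 0 < r /\ forall X, (forall i, (i < m)%nat -> lo i <= X i <= hi i) ->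
    exists c, (forall i, (i < m)%nat -> Rabs (X i - c i) < dl c) /\ r <= dl c.
Proof.
  intros Hdl.
  destruct (compactness_value m (fun_tuple m lo) (fun_tuple m hi)
    (fun v => mkposreal _ (Hdl (tuple_fun m v)))) as [r Hr].
  exists r. split; [apply cond_pos|]. intros X HX.
  (* [compactness_value] provides the centre only under a double negation. *)
  apply NNPP. intros Hno. apply (Hr _ (bounded_fun_tuple m lo hi X HX)).
  intros (v & _ & Hclose & Hle). apply Hno. exists (tuple_fun m v).
  split; [now apply close_fun_tuple | exact Hle].
Qed.

(** * Continuous functions of a scalar state per follower and time *)

(** Joint continuity in the first [n] coordinates and time. As the other coordinates of [X'] are
    unconstrained, it also says that [g] ignores them. *)
Definition state_cont (n : nat) (g : (nat -> R) -> R -> R) : Prop :=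
  forall X t eps, 0 < eps -> exists dl, 0 < dl /\ forall X' t',
    (forall i, (i < n)%nat -> Rabs (X' i - X i) < dl) -> Rabs (t' - t) < dl ->
    Rabs (g X' t' - g X t) < eps.

Lemma state_cont_const n c : state_cont n (fun _ _ => c).
Proof.
  intros X t eps Heps. exists 1. split; [lra|]. intros. rewrite Rminus_diag, Rabs_R0. exact Heps.
Qed.

Lemma state_cont_coord n i : (i < n)%nat -> state_cont n (fun X _ => X i).
Proof. intros Hi X t eps Heps. exists eps. split; [exact Heps|]. intros X' t' HX _. now apply HX. Qed.

Lemma state_cont_plus n f g : state_cont n f -> state_cont n g ->
  state_cont n (fun X t => f X t + g X t).
Proof.
  intros Hf Hg X t eps Heps.
  destruct (Hf X t (eps / 2)) as [d1 [Hd1 H1]]; [lra|].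
  destruct (Hg X t (eps / 2)) as [d2 [Hd2 H2]]; [lra|].
  exists (Rmin d1 d2). split; [now apply Rmin_pos|]. intros X' t' HX Ht.
  pose proof (Rmin_l d1 d2). pose proof (Rmin_r d1 d2).
  specialize (H1 X' t' (fun i Hi => Rlt_le_trans _ _ _ (HX i Hi) H) ltac:(lra)).
  specialize (H2 X' t' (fun i Hi => Rlt_le_trans _ _ _ (HX i Hi) H0) ltac:(lra)).
  replace (f X' t' + g X' t' - (f X t + g X t)) with ((f X' t' - f X t) + (g X' t' - g X t)) by ring.
  eapply Rle_lt_trans; [apply Rabs_triang | lra].
Qed.

Lemma state_cont_mult n f g : state_cont n f -> state_cont n g ->
  state_cont n (fun X t => f X t * g X t).
Proof.
  intros Hf Hg X t eps Heps.
  set (P := Rabs (f X t) + 1). set (Q := Rabs (g X t) + 1).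
  assert (HP : 0 < P) by (unfold P; pose proof (Rabs_pos (f X t)); lra).
  assert (HQ : 0 < Q) by (unfold Q; pose proof (Rabs_pos (g X t)); lra).
  set (e1 := Rmin 1 (eps / (2 * Q))). set (e2 := eps / (2 * P)).
  assert (He1 : 0 < e1) by (apply Rmin_pos; [lra | apply Rdiv_lt_0_compat; lra]).
  assert (He2 : 0 < e2) by (apply Rdiv_lt_0_compat; lra).
  destruct (Hf X t e1 He1) as [d1 [Hd1 H1]]. destruct (Hg X t e2 He2) as [d2 [Hd2 H2]].
  exists (Rmin d1 d2). split; [now apply Rmin_pos|]. intros X' t' HX Ht.
  pose proof (Rmin_l d1 d2). pose proof (Rmin_r d1 d2).
  specialize (H1 X' t' (fun i Hi => Rlt_le_trans _ _ _ (HX i Hi) H) ltac:(lra)).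
  specialize (H2 X' t' (fun i Hi => Rlt_le_trans _ _ _ (HX i Hi) H0) ltac:(lra)).
  replace (f X' t' * g X' t' - f X t * g X t)
    with (f X' t' * (g X' t' - g X t) + (f X' t' - f X t) * g X t) by ring.
  eapply Rle_lt_trans; [apply Rabs_triang|]. rewrite !Rabs_mult.
  assert (HfP : Rabs (f X' t') <= P).
  { unfold P. replace (f X' t') with ((f X' t' - f X t) + f X t) by ring.
    eapply Rle_trans; [apply Rabs_triang|]. pose proof (Rmin_l 1 (eps / (2 * Q))). fold e1 in H3. lra. }
  assert (HgQ : Rabs (g X t) <= Q) by (unfold Q; lra).
  assert (E1 : Rabs (f X' t') * Rabs (g X' t' - g X t) <= P * Rabs (g X' t' - g X t))
    by (apply Rmult_le_compat_r; [apply Rabs_pos | exact HfP]).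
  assert (E2 : P * Rabs (g X' t' - g X t) < P * e2) by (apply Rmult_lt_compat_l; lra).
  replace (P * e2) with (eps / 2) in E2 by (unfold e2; field; lra).
  assert (E3 : Rabs (f X' t' - f X t) * Rabs (g X t) <= e1 * Q)
    by (apply Rmult_le_compat; try apply Rabs_pos; lra).
  assert (E4 : e1 * Q <= eps / (2 * Q) * Q) by (apply Rmult_le_compat_r; [lra | apply Rmin_r]).
  replace (eps / (2 * Q) * Q) with (eps / 2) in E4 by (field; lra). lra.
Qed.

Lemma state_cont_rsum n m (f : nat -> (nat -> R) -> R -> R) :
  (forall j, (j < m)%nat -> state_cont n (f j)) ->
  state_cont n (fun X t => rsum m (fun j => f j X t)).
Proof.
  induction m as [|m IH]; intros H; simpl; [apply state_cont_const|].
  apply (state_cont_plus n (fun X t => rsum m (fun j => f j X t)) (f m)).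
  - apply IH. intros; apply H; lia.
  - apply H; lia.
Qed.

Lemma state_cont_comp n g (X : nat -> R -> R) : state_cont n g ->
  (forall i, (i < n)%nat -> continuity (X i)) -> continuity (fun t => g (fun i => X i t) t).
Proof.
  intros Hg HX t eps Heps. destruct (Hg (fun i => X i t) t eps Heps) as [d [Hd H]].
  destruct (common_delta n (fun i dl => forall s, Rabs (s - t) < dl -> Rabs (X i s - X i t) < d))
    as [d' [Hd' H']].
  - intros i d1 d2 H1 H2 s Hs. apply H1. lra.
  - intros i Hi. destruct (HX i Hi t d Hd) as [dl [Hdl Hl]]. exists dl. split; [exact Hdl|].
    intros s Hs. destruct (Req_dec s t) as [->|Hne]; [rewrite Rminus_diag, Rabs_R0; exact Hd|].
    apply Hl. split; [split; [exact I | lra] | exact Hs].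
  - exists (Rmin d d'). split; [now apply Rmin_pos|]. intros s [_ Hs].
    pose proof (Rmin_l d d'). pose proof (Rmin_r d d'). simpl in *. unfold Rdist in *.
    apply H; [|lra]. intros i Hi. apply H'; [exact Hi | lra].
Qed.

(* The radius at a centre is capped by the inverse of the value there, so that one Lebesgue
   number yields both the bound and the modulus of continuity. *)
Lemma state_cont_box n g lo hi t1 t2 eps : state_cont n g -> 0 < eps ->
  exists dl L, 0 < dl /\ forall X t, (forall i, (i < n)%nat -> lo <= X i <= hi) -> t1 <= t <= t2 ->
    Rabs (g X t) <= L /\
    forall X', (forall i, (i < n)%nat -> Rabs (X' i - X i) < dl) -> Rabs (g X' t - g X t) <= eps.
Proof.
  intros Hg Heps.
  (* The doubled radius leaves room for [X'], which is close to [X] while only [X] is close to the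
     centre. *)
  set (P := fun (c : nat -> R) r => 0 < r /\ r * (1 + Rabs (g (fun i => c (S i)) (c O))) <= 1 /\
    forall X' t', (forall i, (i < n)%nat -> Rabs (X' i - c (S i)) < 2 * r) -> Rabs (t' - c O) < 2 * r ->
      Rabs (g X' t' - g (fun i => c (S i)) (c O)) < eps / 2).
  set (dl := fun c => epsilon (inhabits 0) (P c)).
  assert (Hdl : forall c, P c (dl c)).
  { intros c. unfold dl. apply epsilon_spec.
    destruct (Hg (fun i => c (S i)) (c O) (eps / 2)) as [d [Hd H]]; [lra|].
    set (G := 1 + Rabs (g (fun i => c (S i)) (c O))).
    assert (HG : 0 < G) by (unfold G; pose proof (Rabs_pos (g (fun i => c (S i)) (c O))); lra).
    exists (Rmin (d / 2) (/ G)). pose proof (Rmin_l (d / 2) (/ G)). pose proof (Rmin_r (d / 2) (/ G)).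
    split; [apply Rmin_pos; [lra | now apply Rinv_0_lt_compat]|]. split.
    - fold G. apply Rle_trans with (/ G * G); [apply Rmult_le_compat_r; lra | right; field; lra].
    - intros X' t' HX Ht. apply H; [|lra]. intros i Hi. specialize (HX i Hi). lra. }
  destruct (box_lebesgue (S n) (fun i => match i with O => t1 | S _ => lo end)
    (fun i => match i with O => t2 | S _ => hi end) dl (fun c => proj1 (Hdl c))) as [r [Hr H]].
  exists r, (/ r + eps). split; [exact Hr|]. intros X t HX Ht.
  destruct (H (fun i => match i with O => t | S j => X j end)) as [c [Hc Hrc]].
  { intros [|i] Hi; [exact Ht | apply HX; lia]. }
  destruct (Hdl c) as (Hd0 & Hcap & Hmod).
  assert (Hc0 : Rabs (t - c O) < dl c) by (apply (Hc O); lia).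
  assert (HcS : forall i, (i < n)%nat -> Rabs (X i - c (S i)) < dl c) by (intros i Hi; apply (Hc (S i)); lia).
  set (gc := g (fun i => c (S i)) (c O)) in *.
  assert (HgX : Rabs (g X t - gc) < eps / 2).
  { apply Hmod; [|lra]. intros i Hi. specialize (HcS i Hi). lra. }
  split.
  - assert (Hgc : Rabs gc <= / r).
    { apply Rle_trans with (1 + Rabs gc); [lra|]. apply Rmult_le_reg_l with r; [exact Hr|].
      rewrite Rinv_r by lra. pose proof (Rabs_pos gc).
      assert (r * (1 + Rabs gc) <= dl c * (1 + Rabs gc)) by (apply Rmult_le_compat_r; lra). lra. }
    replace (g X t) with ((g X t - gc) + gc) by ring.
    eapply Rle_trans; [apply Rabs_triang | lra].
  - intros X' HX'.
    assert (HgX' : Rabs (g X' t - gc) < eps / 2).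
    { apply Hmod; [|lra]. intros i Hi. specialize (HcS i Hi). specialize (HX' i Hi).
      replace (X' i - c (S i)) with ((X' i - X i) + (X i - c (S i))) by ring.
      eapply Rle_lt_trans; [apply Rabs_triang | lra]. }
    replace (g X' t - g X t) with ((g X' t - gc) + - (g X t - gc)) by ring.
    eapply Rle_trans; [apply Rabs_triang|]. rewrite Rabs_Ropp. lra.
Qed.

(** * A driven solution with continuous disturbance *)

Lemma continuity_Rmin T : continuity (fun t => Rmin t T).
Proof.
  intros t eps Heps. exists eps. split; [exact Heps|]. intros s [_ Hs].
  simpl in *. unfold Rdist in *. eapply Rle_lt_trans; [|exact Hs].
  unfold Rmin. repeat destruct (Rle_dec _ _); unfold Rabs; repeat destruct (Rcase_abs _); lra.
Qed.

Lemma continuity_Rmax T : continuity (fun t => Rmax t T).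
Proof.
  intros t eps Heps. exists eps. split; [exact Heps|]. intros s [_ Hs].
  simpl in *. unfold Rdist in *. eapply Rle_lt_trans; [|exact Hs].
  unfold Rmax. repeat destruct (Rle_dec _ _); unfold Rabs; repeat destruct (Rcase_abs _); lra.
Qed.

Lemma ex_RInt_continuity f s t : continuity f -> ex_RInt f s t.
Proof.
  intros Hf. apply (ex_RInt_continuous f). intros z _. apply continuity_pt_filterlim, Hf.
Qed.

Lemma derivable_RInt f s t : continuity f -> derivable_pt_lim (fun t => RInt f s t) t (f t).
Proof.
  intros Hf. apply is_derive_Reals, (is_derive_RInt f (RInt f s) s).
  - apply filter_forall. intros r. apply (RInt_correct f), ex_RInt_continuity, Hf.
  - apply continuity_pt_filterlim, Hf.
Qed.

Lemma RInt_between f s t lo hi : continuity f -> s <= t ->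
  (forall r, s <= r <= t -> lo <= f r <= hi) -> lo * (t - s) <= RInt f s t <= hi * (t - s).
Proof.
  intros Hf Hst H. split.
  - replace (lo * (t - s)) with (RInt (fun _ => lo) s t)
      by (rewrite RInt_const; unfold scal; simpl; unfold mult; simpl; ring).
    apply RInt_le; [exact Hst | apply ex_RInt_const | now apply ex_RInt_continuity|].
    intros r Hr. apply H. lra.
  - replace (hi * (t - s)) with (RInt (fun _ => hi) s t)
      by (rewrite RInt_const; unfold scal; simpl; unfold mult; simpl; ring).
    apply RInt_le; [exact Hst | now apply ex_RInt_continuity | apply ex_RInt_const|].
    intros r Hr. apply H. lra.
Qed.

Lemma derivable_pt_lim_local f g t l r : 0 < r -> (forall s, Rabs (s - t) < r -> f s = g s) ->
  derivable_pt_lim f t l -> derivable_pt_lim g t l.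
Proof.
  intros Hr Heq Hf. apply is_derive_Reals. apply is_derive_Reals in Hf.
  apply (is_derive_ext_loc f); [|exact Hf]. exists (mkposreal r Hr). intros s Hs. now apply Heq.
Qed.

Lemma continuity_local f : (forall t, exists g r, 0 < r /\ continuity g /\
  forall s, Rabs (s - t) < r -> f s = g s) -> continuity f.
Proof.
  intros H t. destruct (H t) as (g & r & Hr & Hg & Heq). intros eps Heps.
  destruct (Hg t eps Heps) as [d [Hd Hl]].
  exists (Rmin d r). split; [now apply Rmin_pos|]. intros s [Hs1 Hs2].
  simpl in *. unfold Rdist in *. pose proof (Rmin_l d r). pose proof (Rmin_r d r).
  rewrite !Heq; [apply Hl; split; [exact Hs1 | lra] | rewrite Rminus_diag, Rabs_R0; exact Hr | lra].
Qed.

Lemma dependent_choice_nat (S : Type) (P : nat -> S -> Prop) (Q : nat -> S -> S -> Prop) s0 :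
  P O s0 -> (forall m s, P m s -> exists s', P (Datatypes.S m) s' /\ Q m s s') ->
  exists f, forall m, P m (f m) /\ Q m (f m) (f (Datatypes.S m)).
Proof.
  intros H0 Hstep.
  set (f := fix f m := match m with
    | O => s0
    | Datatypes.S p => epsilon (inhabits s0) (fun s' => P (Datatypes.S p) s' /\ Q p (f p) s')
    end).
  assert (Hf : forall m, P m (f m)).
  { induction m as [|m IH]; [exact H0|]. simpl.
    apply (epsilon_spec (inhabits s0) (fun s' => P (Datatypes.S m) s' /\ Q m (f m) s')).
    now apply Hstep. }
  exists f. intros m. split; [apply Hf|]. simpl.
  apply (epsilon_spec (inhabits s0) (fun s' => P (Datatypes.S m) s' /\ Q m (f m) s')).
  now apply Hstep.
Qed.

(** * Euler steps and their concatenation *)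

Definition coupling_rate (n k : nat) (al be : nat -> nat -> (nat -> R) -> R -> R) (g : digraph)
  (X : nat -> R) (t : R) (i : nat) : R :=
  rsum n (fun j => if arcF g j i then al i j X t * (X j - X i) else 0)
  + rsum k (fun j => if arcL g j i then be i j X t * (0 - X i) else 0).

Section Existence.
Variables (n k : nat) (al be : nat -> nat -> (nat -> R) -> R -> R) (a_hi : R).
Hypotheses
  (Hal : forall i j, (i < n)%nat -> (j < n)%nat ->
     state_cont n (al i j) /\ forall X t, 0 <= al i j X t <= a_hi)
  (Hbe : forall i j, (i < n)%nat -> (j < k)%nat ->
     state_cont n (be i j) /\ forall X t, 0 <= be i j X t)
  (Ha_hi : 0 < a_hi).

Notation rate := (coupling_rate n k al be).

Lemma rate_cont g i : (i < n)%nat -> state_cont n (fun X t => rate g X t i).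
Proof.
  intros Hi.
  assert (Hopp : state_cont n (fun X _ => -1 * X i))
    by (apply (state_cont_mult n (fun _ _ => -1)); [apply state_cont_const | now apply state_cont_coord]).
  apply (state_cont_plus n
    (fun X t => rsum n (fun j => if arcF g j i then al i j X t * (X j - X i) else 0))
    (fun X t => rsum k (fun j => if arcL g j i then be i j X t * (0 - X i) else 0))).
  - apply (state_cont_rsum n n (fun j X t => if arcF g j i then al i j X t * (X j - X i) else 0)).
    intros j Hj. destruct (arcF g j i); [|apply state_cont_const].
    apply (state_cont_mult n (al i j) (fun X _ => X j - X i)); [now apply Hal|].
    replace (fun (X : nat -> R) (_ : R) => X j - X i) with (fun (X : nat -> R) (_ : R) => X j + -1 * X i)
      by (extensionality X; extensionality t; ring).
    apply (state_cont_plus n (fun X _ => X j)); [now apply state_cont_coord | exact Hopp].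
  - apply (state_cont_rsum n k (fun j X t => if arcL g j i then be i j X t * (0 - X i) else 0)).
    intros j Hj. destruct (arcL g j i); [|apply state_cont_const].
    apply (state_cont_mult n (be i j) (fun X _ => 0 - X i)); [now apply Hbe|].
    replace (fun (X : nat -> R) (_ : R) => 0 - X i) with (fun (X : nat -> R) (_ : R) => -1 * X i)
      by (extensionality X; extensionality t; ring).
    exact Hopp.
Qed.

(** Quantitative form of the invariance of [0, m]: the rate points inwards at both ends, with slopes
    that tell how long an Euler step may be. The lower slope needs a bound [L] on the leader
    weights, which exists only on compact sets. *)
Lemma rate_bounds g X t i L m : (i < n)%nat ->
  (forall j, (j < n)%nat -> 0 <= X j <= m) ->
  (forall j, (j < k)%nat -> be i j X t <= L) -> 0 <= L ->
  - (INR n * a_hi + INR k * L) * X i <= rate g X t i <= INR n * a_hi * (m - X i).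
Proof.
  intros Hi HX HL HL0. pose proof (HX i Hi) as HXi. unfold coupling_rate. split.
  - replace (- (INR n * a_hi + INR k * L) * X i)
      with (rsum n (fun _ => - a_hi * X i) + rsum k (fun _ => - L * X i))
      by (rewrite !rsum_const; ring).
    apply Rplus_le_compat; apply rsum_le; intros j Hj.
    + assert (0 <= a_hi * X i) by (apply Rmult_le_pos; lra).
      destruct (arcF g j i); [|lra].
      destruct (Hal i j Hi Hj) as [_ Hb]. specialize (Hb X t). specialize (HX j Hj).
      assert (0 <= al i j X t * X j) by (apply Rmult_le_pos; lra).
      assert (al i j X t * X i <= a_hi * X i) by (apply Rmult_le_compat_r; lra). lra.
    + assert (0 <= L * X i) by (apply Rmult_le_pos; lra).
      destruct (arcL g j i); [|lra].
      assert (be i j X t * X i <= L * X i) by (apply Rmult_le_compat_r; [lra | now apply HL]). lra.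
  - replace (INR n * a_hi * (m - X i)) with (rsum n (fun _ => a_hi * (m - X i)) + rsum k (fun _ => 0))
      by (rewrite !rsum_const; ring).
    apply Rplus_le_compat; apply rsum_le; intros j Hj.
    + assert (0 <= a_hi * (m - X i)) by (apply Rmult_le_pos; lra).
      destruct (arcF g j i); [|lra].
      destruct (Hal i j Hi Hj) as [_ Hb]. specialize (Hb X t). specialize (HX j Hj).
      assert (al i j X t * (X j - X i) <= al i j X t * (m - X i)) by (apply Rmult_le_compat_l; lra).
      assert (al i j X t * (m - X i) <= a_hi * (m - X i)) by (apply Rmult_le_compat_r; lra). lra.
    + destruct (arcL g j i); [|lra].
      destruct (Hbe i j Hi Hj) as [_ Hb]. specialize (Hb X t).
      assert (0 <= be i j X t * X i) by (apply Rmult_le_pos; lra). lra.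
Qed.

(** The step size [h0] is chosen before the starting point, the starting time and the size of the
    state below [M], so finitely many steps cross a whole switching interval. The two tolerances
    1/4, for freezing the state and for the fading correction [rho], add up to 1/2. *)
Lemma uniform_step g M t1 t2 : 0 <= M -> exists h0, 0 < h0 /\
  forall X0 T h m rho, (forall i, (i < n)%nat -> 0 <= X0 i <= m) -> m <= M ->
    t1 <= T -> T + h <= t2 -> 0 < h <= h0 ->
    (forall i, (i < n)%nat -> Rabs (rho i) <= / 4) ->
    let F := fun i r => rate g X0 r i + 1 + rho i * (1 - (r - T) / h) in
    forall i t, (i < n)%nat -> T <= t <= T + h ->
      0 <= X0 i + RInt (F i) T t <= m + 2 * (t - T) /\
      Rabs (rate g (fun j => X0 j + RInt (F j) T t) t i - rate g X0 t i) <= / 4.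
Proof.
  intros HM.
  assert (HL : exists L, 0 <= L /\ forall i j X t, (i < n)%nat -> (j < k)%nat ->
    (forall q, (q < n)%nat -> 0 <= X q <= M) -> t1 <= t <= t2 -> be i j X t <= L).
  { assert (Hb : forall i j, exists L, (i < n)%nat -> (j < k)%nat -> forall X t,
      (forall q, (q < n)%nat -> 0 <= X q <= M) -> t1 <= t <= t2 -> be i j X t <= L).
    { intros i j. destruct (Compare_dec.lt_dec i n) as [Hi|]; [|exists 0; intros; lia].
      destruct (Compare_dec.lt_dec j k) as [Hj|]; [|exists 0; intros; lia].
      destruct (state_cont_box n (be i j) 0 M t1 t2 1 (proj1 (Hbe i j Hi Hj)) ltac:(lra))
        as (dl & L & _ & H). exists L. intros _ _ X t HX Ht.
      destruct (H X t HX Ht) as [H' _]. eapply Rle_trans; [apply Rle_abs | exact H']. }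
    set (Lf := fun i j => epsilon (inhabits 0) (fun L => (i < n)%nat -> (j < k)%nat -> forall X t,
      (forall q, (q < n)%nat -> 0 <= X q <= M) -> t1 <= t <= t2 -> be i j X t <= L)).
    exists (rmax_upto n (fun i => rmax_upto k (fun j => Lf i j))).
    split; [apply rmax_upto_nonneg|]. intros i j X t Hi Hj HX Ht.
    eapply Rle_trans; [|apply (rmax_upto_ge n (fun i => rmax_upto k (fun j => Lf i j)) i Hi)].
    eapply Rle_trans; [|apply (rmax_upto_ge k (fun j => Lf i j) j Hj)].
    unfold Lf. exact (epsilon_spec (inhabits 0) _ (Hb i j) Hi Hj X t HX Ht). }
  destruct HL as (L & HL0 & HL).
  destruct (common_delta n (fun i d => forall X t, (forall q, (q < n)%nat -> 0 <= X q <= M) ->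
      t1 <= t <= t2 -> forall X', (forall q, (q < n)%nat -> Rabs (X' q - X q) < d) ->
      Rabs (rate g X' t i - rate g X t i) <= / 4)) as (d & Hd & Hmod).
  { intros i d1 d2 H Hd X t HX Ht X' HX'. apply H; try assumption.
    intros q Hq. specialize (HX' q Hq). lra. }
  { intros i Hi. destruct (state_cont_box n _ 0 M t1 t2 (/ 4) (rate_cont g i Hi) ltac:(lra))
      as (d & L' & Hd & H). exists d. split; [exact Hd|]. intros X t HX Ht. now apply H. }
  set (A := INR n * a_hi). set (K := A + INR k * L).
  assert (HA : 0 <= A) by (apply Rmult_le_pos; [apply pos_INR | lra]).
  assert (HKL : 0 <= INR k * L) by (apply Rmult_le_pos; [apply pos_INR | lra]).
  assert (HK : 0 <= K) by (unfold K; lra).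
  set (V := K * M + 2).
  assert (HV : 0 < V) by (unfold V; assert (0 <= K * M) by (apply Rmult_le_pos; lra); lra).
  (* The first bound gives [K * h <= 1], so a step cannot make the state negative or its coupling
     part overshoot [m]; the second keeps the displacement [h * V] below the modulus [d]. *)
  exists (Rmin (/ (K + 1)) (d / (2 * V))).
  assert (HK1 : 0 < / (K + 1)) by (apply Rinv_0_lt_compat; lra).
  assert (HdV : 0 < d / (2 * V)) by (apply Rdiv_lt_0_compat; lra).
  split; [now apply Rmin_pos|].
  intros X0 T h m rho HX0 HmM HT1 HT2 Hh Hrho F.
  assert (Hh1 : h * (K + 1) <= 1).
  { apply Rle_trans with (/ (K + 1) * (K + 1)); [|right; field; lra].
    apply Rmult_le_compat_r; [lra|]. eapply Rle_trans; [apply Hh | apply Rmin_l]. }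
  assert (Hh2 : h * V < d).
  { apply Rle_lt_trans with (d / (2 * V) * V).
    - apply Rmult_le_compat_r; [lra|]. eapply Rle_trans; [apply Hh | apply Rmin_r].
    - replace (d / (2 * V) * V) with (d / 2) by (field; lra). lra. }
  assert (HX0M : forall q, (q < n)%nat -> 0 <= X0 q <= M) by (intros q Hq; specialize (HX0 q Hq); lra).
  assert (HFc : forall i, (i < n)%nat -> continuity (F i)).
  { intros i Hi. unfold F. apply continuity_plus; [apply continuity_plus|].
    - apply (state_cont_comp n (fun X t => rate g X t i) (fun q _ => X0 q)); [now apply rate_cont|].
      intros q _. apply continuity_const. intros ? ?; reflexivity.
    - apply continuity_const. intros ? ?; reflexivity.
    - apply derivable_continuous. reg. }
  assert (HFb : forall i r, (i < n)%nat -> T <= r <= T + h ->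
    3 / 4 - K * X0 i <= F i r <= A * (m - X0 i) + 5 / 4).
  { intros i r Hi Hr.
    destruct (rate_bounds g X0 r i L m Hi HX0) as [Hlo Hhi].
    { intros j Hj. apply HL; try assumption. lra. }
    { exact HL0. }
    fold A in Hlo, Hhi. fold K in Hlo.
    assert (Hramp : 0 <= 1 - (r - T) / h <= 1).
    { assert (0 <= (r - T) / h <= 1); [|lra]. split.
      - apply Rmult_le_reg_r with h; [lra|]. replace ((r - T) / h * h) with (r - T) by (field; lra). lra.
      - apply Rmult_le_reg_r with h; [lra|]. replace ((r - T) / h * h) with (r - T) by (field; lra). lra. }
    specialize (Hrho i Hi).
    assert (Hrr : Rabs (rho i * (1 - (r - T) / h)) <= / 4).
    { rewrite Rabs_mult, (Rabs_right (1 - _)) by lra. pose proof (Rabs_pos (rho i)). nra. }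
    apply Rabs_le_between in Hrr. unfold F. lra. }
  intros i t Hi Ht.
  assert (Hint : forall j, (j < n)%nat ->
    (3 / 4 - K * X0 j) * (t - T) <= RInt (F j) T t <= (A * (m - X0 j) + 5 / 4) * (t - T)).
  { intros j Hj. apply RInt_between; [now apply HFc | lra|]. intros r Hr. apply HFb; [exact Hj | lra]. }
  assert (Htau : 0 <= t - T <= h) by lra. set (tau := t - T) in *.
  assert (HKt : K * tau <= 1) by nra.
  split.
  - specialize (Hint i Hi). specialize (HX0 i Hi).
    assert (K * tau * X0 i <= 1 * X0 i) by (apply Rmult_le_compat_r; lra).
    assert (HAK : A * tau <= 1) by (unfold K in HKt; nra).
    assert (A * tau * (m - X0 i) <= 1 * (m - X0 i)) by (apply Rmult_le_compat_r; lra).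
    split; nra.
  - apply (Hmod i Hi X0 t HX0M ltac:(lra)). intros j Hj.
    rewrite Rplus_minus_l.
    apply Rle_lt_trans with (h * V); [|exact Hh2].
    specialize (Hint j Hj). specialize (HX0 j Hj).
    assert (HKX : 0 <= K * X0 j <= K * M) by (split; [apply Rmult_le_pos; lra | apply Rmult_le_compat_l; lra]).
    assert (HAX : 0 <= A * (m - X0 j) <= K * M).
    { split; [apply Rmult_le_pos; lra|]. apply Rmult_le_compat; unfold K; lra. }
    assert (HhV : tau * V <= h * V) by (apply Rmult_le_compat_r; lra).
    apply Rabs_le. unfold V in *. split; nra.
Qed.


Variables (sigma : R -> digraph) (s : nat -> R).
Hypotheses (Hs0 : s O = 0) (Hsinc : forall m, s m < s (S m))
  (Hsinf : forall t, exists m, t <= s m)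
  (Hconst : forall m t, s m <= t < s (S m) -> sigma t = sigma (s m)).

Record path := Path { px : nat -> R -> R; pw : nat -> R -> R; pl : list R }.

(* The list pl holds the times at which the state px need not be differentiable. The sharper
   bound on the disturbance pw at T leaves room for the next step. *)
Definition seg (T : R) (P : path) : Prop :=
  (forall i, (i < n)%nat -> continuity (px P i) /\ continuity (pw P i)) /\
  (forall i t, (i < n)%nat -> 0 <= t <= T -> 0 <= px P i t <= 2 * t /\ Rabs (pw P i t - 1) <= / 2) /\
  (forall i, (i < n)%nat -> Rabs (pw P i T - 1) <= / 4) /\
  (forall t, 0 < t < T -> ~ In t (pl P) -> forall i, (i < n)%nat ->
     derivable_pt_lim (px P i) t (rate (sigma t) (fun j => px P j t) t i + pw P i t)).

Definition agree (T : R) (P P' : path) : Prop :=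
  forall i t, t <= T -> px P' i t = px P i t /\ pw P' i t = pw P i t.

(* One Euler step with the state frozen in the rate. The disturbance is the residual with
   respect to the true rate; the term rho carries over its value at T, which makes the
   disturbance continuous at T even if the graph switches there. *)
Lemma seg_step m : exists h0, 0 < h0 /\ forall T h P, s m <= T -> 0 < h <= h0 -> T + h <= s (S m) ->
  seg T P -> exists P', seg (T + h) P' /\ agree T P P'.
Proof.
  assert (Hsm : forall m, 0 <= s m).
  { induction m0 as [|m0 IH]; [lra|]. specialize (Hsinc m0). lra. }
  set (g := sigma (s m)).
  (* By the invariant [px <= 2 * t], this one box contains the state up to the next switching time,
     whatever the number of steps. *)
  destruct (uniform_step g (2 * s (S m)) (s m) (s (S m))) as (h0 & Hh0 & Hstep).
  { specialize (Hsm (S m)). lra. }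
  exists h0. split; [exact Hh0|].
  intros T h P HT Hh HTh (Hcont & Hbd & Hend & Hder).
  specialize (Hsm m).
  set (X0 := fun i => px P i T). set (rho := fun i => pw P i T - 1).
  set (F := fun i r => rate g X0 r i + 1 + rho i * (1 - (r - T) / h)).
  assert (HX0 : forall i, (i < n)%nat -> 0 <= X0 i <= 2 * T).
  { intros i Hi. apply (Hbd i T Hi). lra. }
  specialize (Hstep X0 T h (2 * T) rho HX0 ltac:(lra) HT HTh Hh Hend). fold F in Hstep.
  assert (HFc : forall i, (i < n)%nat -> continuity (F i)).
  { intros i Hi. unfold F. apply continuity_plus; [apply continuity_plus|].
    - apply (state_cont_comp n (fun X t => rate g X t i) (fun q _ => X0 q)); [now apply rate_cont|].
      intros q _. apply continuity_const. intros ? ?; reflexivity.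
    - apply continuity_const. intros ? ?; reflexivity.
    - apply derivable_continuous. reg. }
  set (Y := fun i t => X0 i + RInt (F i) T t).
  set (V := fun i t => F i t - rate g (fun j => Y j t) t i).
  assert (HYT : forall i, Y i T = X0 i).
  { intros i. unfold Y. rewrite RInt_point. apply Rplus_0_r. }
  assert (HVT : forall i, V i T = pw P i T).
  { intros i. unfold V.
    replace (fun j => Y j T) with X0 by (extensionality j; symmetry; apply HYT).
    unfold F, rho. field. lra. }
  assert (HYd : forall i t, (i < n)%nat -> derivable_pt_lim (Y i) t (F i t)).
  { intros i t Hi. unfold Y. rewrite <- (Rplus_0_l (F i t)).
    apply (derivable_pt_lim_plus (fun _ => X0 i) (fun t => RInt (F i) T t));
      [apply derivable_pt_lim_const | apply derivable_RInt, HFc, Hi]. }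
  assert (HYc : forall i, (i < n)%nat -> continuity (Y i)).
  { intros i Hi. apply derivable_continuous. intros t. exists (F i t). now apply HYd. }
  assert (HVc : forall i, (i < n)%nat -> continuity (V i)).
  { intros i Hi. apply continuity_minus; [now apply HFc|].
    apply (state_cont_comp n (fun X t => rate g X t i) Y); [now apply rate_cont | exact HYc]. }
  assert (HVb : forall i t, (i < n)%nat -> T <= t <= T + h ->
    V i t - 1 = (rate g X0 t i - rate g (fun j => Y j t) t i) + rho i * (1 - (t - T) / h)).
  { intros i t Hi Ht. unfold V, F. ring. }
  (* Gluing by clamping the time instead of a case distinction: continuity is then that of a sum of
     compositions. *)
  set (glue := fun (f f' : nat -> R -> R) i t => f i (Rmin t T) + (f' i (Rmax t T) - f' i T)).
  assert (Hleft : forall f f' i t, t <= T -> glue f f' i t = f i t).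
  { intros f f' i t Ht. unfold glue. rewrite Rmin_left, Rmax_right by lra. ring. }
  assert (Hright : forall f f' i t, f' i T = f i T -> T <= t -> glue f f' i t = f' i t).
  { intros f f' i t E Ht. unfold glue. rewrite Rmin_right, Rmax_left by lra. rewrite E. ring. }
  assert (Hgluec : forall f f' i, continuity (f i) -> continuity (f' i) -> continuity (glue f f' i)).
  { intros f f' i Hf Hf'. unfold glue.
    apply (continuity_plus (fun t => f i (Rmin t T)) (fun t => f' i (Rmax t T) - f' i T)).
    - apply (continuity_comp (fun t => Rmin t T) (f i)); [apply continuity_Rmin | exact Hf].
    - apply (continuity_minus (fun t => f' i (Rmax t T)) (fun _ => f' i T)).
      + apply (continuity_comp (fun t => Rmax t T) (f' i)); [apply continuity_Rmax | exact Hf'].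
      + apply continuity_const. intros ? ?; reflexivity. }
  exists (Path (glue (px P) Y) (glue (pw P) V) (T :: pl P)). unfold seg, agree; simpl. split.
  - split; [|split; [|split]].
    + intros i Hi. destruct (Hcont i Hi). split; apply Hgluec; auto.
    + intros i t Hi Ht. destruct (Rle_lt_dec t T) as [Hle|Hgt].
      * rewrite !Hleft by lra. apply Hbd; [exact Hi | lra].
      * rewrite (Hright (px P) Y), (Hright (pw P) V) by (try apply HYT; try apply HVT; lra).
        destruct (Hstep i t Hi ltac:(lra)) as [H1 H2]. split; [fold (Y i t) in H1; lra|].
        rewrite HVb by (try exact Hi; lra).
        change (fun j => X0 j + RInt (F j) T t) with (fun j => Y j t) in H2.
        assert (Hramp : 0 <= 1 - (t - T) / h <= 1).
        { assert (0 <= (t - T) / h <= 1); [|lra]. split.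
          - apply Rmult_le_reg_r with h; [lra|]. replace ((t - T) / h * h) with (t - T) by (field; lra). lra.
          - apply Rmult_le_reg_r with h; [lra|]. replace ((t - T) / h * h) with (t - T) by (field; lra). lra. }
        specialize (Hend i Hi). fold (rho i) in Hend.
        assert (Hrr : Rabs (rho i * (1 - (t - T) / h)) <= / 4).
        { rewrite Rabs_mult, (Rabs_right (1 - _)) by lra. pose proof (Rabs_pos (rho i)). nra. }
        rewrite Rabs_minus_sym in H2.
        eapply Rle_trans; [apply Rabs_triang|]. lra.
    + intros i Hi. rewrite (Hright (pw P) V) by (try apply HVT; lra).
      destruct (Hstep i (T + h) Hi ltac:(lra)) as [_ H2].
      change (fun j => X0 j + RInt (F j) T (T + h)) with (fun j => Y j (T + h)) in H2.
      rewrite HVb by (try exact Hi; lra).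
      replace (1 - (T + h - T) / h) with 0 by (field; lra).
      rewrite Rmult_0_r, Rplus_0_r, Rabs_minus_sym. exact H2.
    + intros t Ht Hin i Hi.
      assert (Hne : t <> T) by (intros ->; apply Hin; now left).
      destruct (Rlt_le_dec t T) as [Hlt|Hge].
      * replace (fun j => glue (px P) Y j t) with (fun j => px P j t)
          by (extensionality j; symmetry; apply Hleft; lra).
        rewrite (Hleft (pw P) V) by lra.
        apply (derivable_pt_lim_local (px P i) _ t _ (T - t)); [lra| |].
        -- intros r Hr. symmetry. apply Hleft. apply Rabs_def2 in Hr. lra.
        -- apply Hder; [lra | intros H; apply Hin; now right | exact Hi].
      * replace (fun j => glue (px P) Y j t) with (fun j => Y j t)
          by (extensionality j; symmetry; apply Hright; [apply HYT | lra]).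
        rewrite (Hright (pw P) V) by (try apply HVT; lra).
        rewrite (Hconst m t) by lra. fold g.
        replace (rate g (fun j => Y j t) t i + V i t) with (F i t) by (unfold V; ring).
        apply (derivable_pt_lim_local (Y i) _ t _ (t - T)); [lra| |].
        -- intros r Hr. symmetry. apply Hright; [apply HYT|]. apply Rabs_def2 in Hr. lra.
        -- now apply HYd.
  - intros i t Ht. now rewrite !Hleft.
Qed.

Lemma seg_extend m P : seg (s m) P -> exists P', seg (s (S m)) P' /\ agree (s m) P P'.
Proof.
  intros HP. destruct (seg_step m) as (h0 & Hh0 & Hstep).
  pose proof (Hsinc m) as Hlt.
  destruct (INR_unbounded ((s (S m) - s m) / h0)) as [N HN].
  assert (HN0 : 0 < INR N).
  { eapply Rle_lt_trans; [|exact HN]. apply Rlt_le, Rdiv_lt_0_compat; lra. }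
  set (h := (s (S m) - s m) / INR N).
  assert (Hh : 0 < h) by (apply Rdiv_lt_0_compat; lra).
  assert (HhN : INR N * h = s (S m) - s m) by (unfold h; field; lra).
  assert (Hhh : h <= h0).
  { apply Rmult_le_reg_l with (INR N); [exact HN0|]. rewrite HhN.
    apply (Rmult_lt_compat_r h0) in HN; [|exact Hh0].
    replace ((s (S m) - s m) / h0 * h0) with (s (S m) - s m) in HN by (field; lra). lra. }
  assert (Hq : forall q, (q <= N)%nat -> exists P', seg (s m + INR q * h) P' /\ agree (s m) P P').
  { induction q as [|q IH]; intros HqN.
    - exists P. simpl. rewrite Rmult_0_l, Rplus_0_r. split; [exact HP | now split].
    - destruct IH as (P1 & HP1 & Hag); [lia|].
      assert (Hq0 : 0 <= INR q * h) by (apply Rmult_le_pos; [apply pos_INR | lra]).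
      assert (HqN' : INR (S q) * h <= INR N * h) by (apply Rmult_le_compat_r; [lra | now apply le_INR]).
      rewrite S_INR in *.
      destruct (Hstep (s m + INR q * h) h P1) as (P2 & HP2 & Hag2); try assumption; try lra.
      exists P2. replace (s m + (INR q + 1) * h) with (s m + INR q * h + h) by ring.
      split; [exact HP2|]. intros i t Ht.
      destruct (Hag i t Ht) as [<- <-]. apply Hag2. lra. }
  destruct (Hq N (le_n N)) as (P' & HP' & Hag). exists P'. split; [|exact Hag].
  replace (s (S m)) with (s m + INR N * h) by lra. exact HP'.
Qed.

Lemma driven_solution : exists (x w : nat -> R -> R) (e : nat -> R),
  (forall i, (i < n)%nat -> continuity (x i) /\ continuity (w i)) /\
  (forall i t, (i < n)%nat -> 0 <= t -> 0 <= x i t <= 2 * t /\ Rabs (w i t - 1) <= / 2) /\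
  (forall t, 0 < t -> (forall m, t <> e m) -> forall i, (i < n)%nat ->
     derivable_pt_lim (x i) t (rate (sigma t) (fun j => x j t) t i + w i t)).
Proof.
  destruct (dependent_choice_nat path (fun m => seg (s m)) (fun m => agree (s m))
    (Path (fun _ _ => 0) (fun _ _ => 1) nil)) as [f Hf].
  { rewrite Hs0. split; [|split; [|split]]; simpl.
    - intros i _. split; apply continuity_const; intros ? ?; reflexivity.
    - intros i t _ Ht. rewrite Rminus_diag, Rabs_R0. lra.
    - intros i _. rewrite Rminus_diag, Rabs_R0. lra.
    - intros t Ht. lra. }
  { intros m P HP. now apply seg_extend. }
  assert (Hsle : forall m q, s m <= s (m + q)%nat).
  { intros m q. induction q as [|q IH]; [rewrite Nat.add_0_r; lra|].
    rewrite Nat.add_succ_r. specialize (Hsinc (m + q)%nat). lra. }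
  assert (Hag : forall m q, agree (s m) (f m) (f (m + q)%nat)).
  { intros m q. induction q as [|q IH]; [rewrite Nat.add_0_r; now split|].
    intros i t Ht. destruct (IH i t Ht) as [<- <-]. rewrite Nat.add_succ_r.
    apply (proj2 (Hf (m + q)%nat)). specialize (Hsle m q). lra. }
  (* Some stage whose horizon covers [t]; since the stages agree on common horizons, the choice does
     not affect the value. *)
  set (N := fun t => epsilon (inhabits O) (fun m => t <= s m)).
  assert (HN : forall t, t <= s (N t)) by (intros t; apply (epsilon_spec (inhabits O) (fun m => t <= s m)), Hsinf).
  set (x := fun i t => px (f (N t)) i t). set (w := fun i t => pw (f (N t)) i t).
  assert (Heq : forall m i t, t <= s m -> x i t = px (f m) i t /\ w i t = pw (f m) i t).
  { intros m i t Ht. unfold x, w.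
    destruct (Hag m (N t) i t Ht) as [<- <-].
    destruct (Hag (N t) m i t (HN t)) as [<- <-]. now rewrite (Nat.add_comm m). }
  (* Cantor pairing enumerates the union of the finite lists. The default 0 of [nth] is harmless
     because only positive times are tested. *)
  exists x, w, (fun p => let (m, i) := Cantor.of_nat p in nth i (pl (f m)) 0).
  assert (Hloc : forall t, exists m, t + 1 <= s m /\ seg (s m) (f m)).
  { intros t. destruct (Hsinf (t + 1)) as [m Hm]. exists m. split; [exact Hm | apply Hf]. }
  split; [|split].
  - intros i Hi. split; apply continuity_local; intros t; destruct (Hloc t) as (m & Hm & Hseg).
    + exists (px (f m) i), 1. split; [lra|]. split; [now apply Hseg|].
      intros r Hr. apply Rabs_def2 in Hr. apply Heq. lra.
    + exists (pw (f m) i), 1. split; [lra|]. split; [now apply Hseg|].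
      intros r Hr. apply Rabs_def2 in Hr. apply Heq. lra.
  - intros i t Hi Ht. destruct (Hloc t) as (m & Hm & Hseg).
    destruct (Heq m i t ltac:(lra)) as [-> ->]. apply Hseg; [exact Hi | lra].
  - intros t Ht He i Hi. destruct (Hloc t) as (m & Hm & Hseg).
    rewrite (proj2 (Heq m i t ltac:(lra))).
    replace (fun j => x j t) with (fun j => px (f m) j t)
      by (extensionality j; symmetry; apply (Heq m j t); lra).
    apply (derivable_pt_lim_local (px (f m) i) _ t _ 1); [lra| |].
    + intros r Hr. apply Rabs_def2 in Hr. symmetry. apply Heq. lra.
    + apply Hseg; [lra | | exact Hi]. intros Hin.
      destruct (In_nth _ _ 0 Hin) as (q & _ & Hq).
      apply (He (Cantor.to_nat (m, q))). now rewrite Cantor.cancel_of_to.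
Qed.

End Existence.

(** * Necessity of uniform joint connectivity *)

Definition first_coord (X : nat -> R) (i c : nat) : R := if Nat.eq_dec c 0 then X i else 0.

Definition origin (i c : nat) : R := 0.

Lemma first_coord_sq_sum d (X : nat -> R) i : (1 <= d)%nat ->
  rsum d (fun c => first_coord X i c ^ 2) = X i ^ 2.
Proof.
  intros Hd. rewrite <- (rsum_indicator d 0 (fun _ => X i ^ 2)) by lia.
  apply rsum_ext. intros c _. unfold first_coord. destruct (Nat.eq_dec c 0); ring.
Qed.

Lemma cont_xyt_first_coord n k d g : (1 <= d)%nat -> cont_xyt n k d g ->
  state_cont n (fun X t => g (first_coord X) origin t).
Proof.
  intros Hd Hg X t eps Heps.
  destruct (Hg (first_coord X) origin t eps Heps) as [dl [Hdl H]].
  pose proof (pos_INR n) as Hn.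
  (* With [n] coordinates within [r], the Euclidean distance is at most [r * INR n], less than
     [dl / 2]; the other half is left for time. *)
  set (r := dl / (2 * (INR n + 1))).
  assert (Hr : 0 < r) by (apply Rdiv_lt_0_compat; lra).
  assert (Hrn : r * (INR n + 1) = dl / 2) by (unfold r; field; lra).
  exists (Rmin r (dl / 2)). split; [apply Rmin_pos; lra|]. intros X' t' HX Ht.
  pose proof (Rmin_l r (dl / 2)) as Hm1. pose proof (Rmin_r r (dl / 2)) as Hm2.
  apply H.
  assert (H1 : sdist n d (first_coord X) (first_coord X') <= r * INR n).
  { unfold sdist. rewrite <- (sqrt_pow2 (r * INR n)) by (apply Rmult_le_pos; lra).
    apply sqrt_le_1_alt. apply Rle_trans with (rsum n (fun _ => r ^ 2)).
    - apply rsum_le. intros i Hi.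
      rewrite (rsum_ext d _ (fun c => first_coord (fun i => X i - X' i) i c ^ 2)).
      + rewrite first_coord_sq_sum by exact Hd. apply pow_maj_Rabs. specialize (HX i Hi).
        rewrite Rabs_minus_sym. lra.
      + intros c _. unfold first_coord. destruct (Nat.eq_dec c 0); ring.
    - rewrite rsum_const.
      assert (INR n <= INR n * INR n).
      { destruct n as [|p]; [simpl; lra|].
        assert (1 <= INR (S p)) by (change 1 with (INR 1); apply le_INR; lia). nra. }
      assert (0 <= r ^ 2) by apply pow2_ge_0. nra. }
  assert (H2 : sdist k d origin origin = 0).
  { unfold sdist. rewrite rsum_0; [apply sqrt_0|]. intros i _. apply rsum_0. intros c _. unfold origin. ring. }
  rewrite H2. lra.
Qed.

Lemma hull_dist_origin k d X i : (1 <= k)%nat -> (1 <= d)%nat ->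
  hull_dist k d origin (first_coord X i) = Rabs (X i).
Proof.
  intros Hk Hd. destruct (hull_dist_is_inf k d origin (first_coord X i) Hk) as [Hlow Hglb].
  assert (Hval : forall q, in_hull k d origin q ->
    vnorm d (fun c => first_coord X i c - q c) = Rabs (X i)).
  { intros q (lam & _ & _ & Hq). rewrite <- sqrt_Rsqr_abs. unfold vnorm. f_equal.
    rewrite (rsum_ext d _ (fun c => first_coord X i c ^ 2)).
    - rewrite first_coord_sq_sum by exact Hd. unfold Rsqr. ring.
    - intros c Hc. rewrite Hq by exact Hc. rewrite rsum_0 by (intros; unfold origin; ring). ring. }
  apply Rle_antisym.
  - apply Hlow. exists (origin 0%nat). split; [apply (in_hull_vertex k d origin); lia|].
    symmetry. apply Hval. apply (in_hull_vertex k d origin). lia.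
  - apply Hglb. intros s (q & Hq & ->). right. symmetry. now apply Hval.
Qed.

Section Necessity.
Variables (n k d : nat) (sigma : R -> digraph) (tauD : R) (a b : weight) (a_lo a_hi b_lo : R).
Hypotheses (Hk : (1 <= k)%nat) (Hd : (1 <= d)%nat) (HtauD : 0 < tauD)
  (Hdwell : dwell_time sigma tauD) (Ha : 0 < a_lo) (Hah : a_lo <= a_hi) (Hb : 0 < b_lo)
  (Hw : weights_ok n k d a b a_lo a_hi b_lo).

Let al i j X t := a i j (first_coord X) origin t.
Let be i j X t := b i j (first_coord X) origin t.

Lemma driven_trajectory : exists (x w : nat -> R -> R) (e : nat -> R),
  (forall i, (i < n)%nat -> continuity (x i) /\ continuity (w i)) /\
  (forall i t, (i < n)%nat -> 0 <= t -> 0 <= x i t <= 2 * t /\ Rabs (w i t - 1) <= / 2) /\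
  (forall t, 0 < t -> (forall m, t <> e m) -> forall i, (i < n)%nat ->
     derivable_pt_lim (x i) t (coupling_rate n k al be (sigma t) (fun j => x j t) t i + w i t)).
Proof.
  destruct Hdwell as (s & Hs0 & Hs & Hc). destruct Hw as [Hwa Hwb].
  apply (driven_solution n k al be a_hi) with (s := s); try assumption; try lra.
  - intros i j Hi Hj. destruct (Hwa i j Hi Hj) as [Hc1 Hb1]. split.
    + now apply (cont_xyt_first_coord n k d (a i j)).
    + intros X t. specialize (Hb1 (first_coord X) origin t). unfold al. lra.
  - intros i j Hi Hj. destruct (Hwb i j Hi Hj) as [Hc1 Hb1]. split.
    + now apply (cont_xyt_first_coord n k d (b i j)).
    + intros X t. specialize (Hb1 (first_coord X) origin t). unfold be. lra.
  - intros m. specialize (Hs m). lra.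
  - intros t. destruct (INR_unbounded (t / tauD)) as [m Hm]. exists m.
    pose proof (dwell_lower s tauD Hs0 Hs m).
    apply (Rmult_lt_compat_r tauD) in Hm; [|exact HtauD].
    replace (t / tauD * tauD) with t in Hm by (field; lra). lra.
Qed.

(** The followers start at the common position of the leaders, so the term in [beta] vanishes and
    the one in [gamma] bounds them for all time. Zero leader input keeps the hull at the origin. *)
Lemma SISS_bounds_driven (x w : nat -> R -> R) (e : nat -> R) : SISS n k d sigma a b ->
  (forall i, (i < n)%nat -> continuity (x i) /\ continuity (w i)) ->
  (forall i t, (i < n)%nat -> 0 <= t -> 0 <= x i t <= 2 * t /\ Rabs (w i t - 1) <= / 2) ->
  (forall t, 0 < t -> (forall m, t <> e m) -> forall i, (i < n)%nat ->
     derivable_pt_lim (x i) t (coupling_rate n k al be (sigma t) (fun j => x j t) t i + w i t)) ->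
  exists C, forall i t, (i < n)%nat -> 0 <= t -> x i t <= C.
Proof.
  intros (beta & gamma & (HKL & _) & (_ & Hg0 & Hgm) & HS) Hcont Hbd Hder.
  set (u := fun (i : nat) (_ : nat -> nat -> R) (_ : R) (_ : nat) => 0).
  set (wd := fun i t c => first_coord (fun i => w i t) i c).
  set (X := fun t => first_coord (fun i => x i t)).
  assert (Hcont0 : forall c, cont_nonneg (fun _ => c)).
  { intros c r _ eps Heps. exists 1. split; [lra|]. intros. rewrite Rminus_diag, Rabs_R0. exact Heps. }
  assert (Hu : admissible_u k d u).
  { intros i c _ _. split.
    - intros t _ y eps Heps. exists 1. split; [lra|]. intros. unfold u. rewrite Rminus_diag, Rabs_R0. exact Heps.
    - intros y. exists INR. split; [reflexivity|]. split; [intros m; rewrite S_INR; lra|].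
      split; [intros M; destruct (INR_unbounded M) as [m Hm]; now exists m|].
      intros m. split; [intros t _; apply continuity_const; intros ? ?; reflexivity|].
      split; exists 0; intros eps Heps; exists 1; (split; [lra|]); intros; unfold u;
        rewrite Rminus_diag, Rabs_R0; exact Heps. }
  assert (Hwd : admissible_w n d wd).
  { intros i c Hi _. unfold wd, first_coord. destruct (Nat.eq_dec c 0); [now apply Hcont|].
    apply continuity_const. intros ? ?; reflexivity. }
  assert (Hsol : is_solution n k d sigma a b u wd X (fun _ => origin)).
  { split; [|split].
    - intros i c Hi _. unfold X, first_coord. destruct (Nat.eq_dec c 0); [|apply Hcont0].
      intros r Hr eps Heps.
      destruct (cont_on_of_continuity 0 (r + 1) (x i) (proj1 (Hcont i Hi)) r ltac:(lra) eps Heps)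
        as [dl [Hdl H]].
      exists (Rmin dl 1). split; [apply Rmin_pos; lra|]. intros s Hs Hsr.
      pose proof (Rmin_l dl 1). pose proof (Rmin_r dl 1).
      apply H; [|lra]. apply Rabs_def2 in Hsr. lra.
    - intros i c _ _. apply Hcont0.
    - exists e. intros t Ht Hte. split.
      + intros i c Hi _. unfold rhs_x, wd, X, first_coord. destruct (Nat.eq_dec c 0) as [_|_].
        * apply (Hder t Ht Hte i Hi).
        * rewrite !rsum_0; [rewrite !Rplus_0_r; apply derivable_pt_lim_const | |];
            intros j _; [destruct (arcL _ _ _) | destruct (arcF _ _ _)]; unfold origin; ring.
      + intros i c _ _. apply derivable_pt_lim_const. }
  assert (Hz : forall t, 0 <= t -> znorm n k d u wd (fun _ => origin) t <= 2 * INR n).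
  { intros t Ht. unfold znorm.
    pose proof (pos_INR n) as Hn.
    rewrite <- (sqrt_pow2 (2 * INR n)) by lra. apply sqrt_le_1_alt.
    rewrite (rsum_0 k), Rplus_0_l by (intros; apply rsum_0; intros; unfold u; ring).
    apply Rle_trans with (rsum n (fun _ => 4)).
    - apply rsum_le. intros i Hi. unfold wd. rewrite first_coord_sq_sum by exact Hd.
      destruct (Hbd i t Hi Ht) as [_ Hwi]. apply Rabs_le_between in Hwi. nra.
    - rewrite rsum_const. destruct n as [|p]; [simpl; lra|].
      assert (1 <= INR (S p)) by (change 1 with (INR 1); apply le_INR; lia). nra. }
  assert (Hzb : z_bounded n k d u wd (fun _ => origin)) by (exists (2 * INR n); exact Hz).
  specialize (HS u wd X (fun _ => origin) Hu Hwd Hsol Hzb).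
  set (Z := z_supnorm n k d u wd (fun _ => origin)) in *.
  assert (HZ0 : 0 <= Z) by (apply z_supnorm_nonneg; exact Hzb).
  assert (HZ : Z <= 2 * INR n).
  { apply (is_lub_sup_of (fun s => exists t, 0 <= t /\ s = znorm n k d u wd (fun _ => origin) t)).
    - eexists. exists 0. split; [lra | reflexivity].
    - exists (2 * INR n). intros s (t & Ht & ->). now apply Hz.
    - intros s (t & Ht & ->). now apply Hz. }
  (* The added 1 gives a strict inequality between arguments, as the monotonicity of [gamma] is
     stated. *)
  exists (gamma (2 * INR n + 1)). intros i t Hi Ht. specialize (HS t Ht). cbv beta in HS.
  assert (H0 : Ldist n k d (X 0) origin = 0).
  { apply Rle_antisym; [|apply rmax_upto_nonneg]. apply rmax_upto_lub; [lra|].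
    intros j Hj. unfold X. rewrite hull_dist_origin by assumption.
    destruct (Hbd j 0 Hj ltac:(lra)) as [Hx _].
    replace (x j 0) with 0 by lra. rewrite Rabs_R0. lra. }
  rewrite H0 in HS. destruct (HKL t Ht) as (_ & Hb0 & _). rewrite Hb0 in HS.
  pose proof (Hgm Z (2 * INR n + 1) HZ0 ltac:(lra)).
  pose proof (rmax_upto_ge n (fun i => hull_dist k d origin (X t i)) i Hi) as Hxi.
  cbv beta in Hxi. unfold X at 1 in Hxi. rewrite hull_dist_origin in Hxi by assumption.
  pose proof (Rle_abs (x i t)). unfold Ldist in HS. lra.
Qed.

Lemma SISS_UJLC : SISS n k d sigma a b -> UJLC n k sigma.
Proof.
  intros HS. destruct driven_trajectory as (x & w & e & Hcont & Hbd & Hder).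
  destruct (SISS_bounds_driven x w e HS Hcont Hbd Hder) as [C HC].
  (* Growth at rate 1/2 during this time yields at least [Rabs C + 1]. *)
  set (T := 2 * Rabs C + 2). pose proof (Rabs_pos C) as HCp. pose proof (Rle_abs C) as HCa.
  assert (HT : 0 < T) by (unfold T; lra).
  exists T. split; [exact HT|]. intros t0 Ht0 i0 Hi0. apply NNPP. intros Hnr.
  set (reached := reach n k (jointF sigma t0 (t0 + T)) (jointL sigma t0 (t0 + T))) in *.
  (* Reached followers get the constant 0, which is never negative, so the minimum principle tests
     unreached ones only. These share the same ramp, hence comparing [th] compares their states. *)
  set (th := fun i t => if excluded_middle_informative (reached i) then 0
                        else x i t + (0 + - / 2 * (t - t0))).
  assert (Hth : 0 <= th i0 (t0 + T)).
  { apply (min_principle n th e t0 (t0 + T)); try lra; try exact Hi0.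
    - intros i Hi. unfold th. destruct (excluded_middle_informative (reached i)).
      + apply cont_on_const.
      + apply cont_on_plus; [apply cont_on_of_continuity; now apply Hcont | apply cont_on_affine].
    - intros i t Hi Ht Hte Hneg Hmin. unfold th in Hneg |- *.
      destruct (excluded_middle_informative (reached i)) as [Hri|Hri] eqn:Ei; [lra|].
      exists (coupling_rate n k al be (sigma t) (fun j => x j t) t i + w i t + - / 2). split.
      { apply (derivable_pt_lim_plus (x i) (fun t => 0 + - / 2 * (t - t0)));
          [apply Hder; [lra | exact Hte | exact Hi] | apply derivable_affine]. }
      destruct (Hbd i t Hi ltac:(lra)) as [_ Hwi]. apply Rabs_le_between in Hwi.
      assert (0 <= coupling_rate n k al be (sigma t) (fun j => x j t) t i); [|lra].
      apply Rplus_le_le_0_compat; apply rsum_nonneg; intros j Hj.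
      + destruct (arcF (sigma t) j i) eqn:Harc; [|lra].
        (* An arc active inside the window from a reached follower would make [i] reached; the same
           reasoning excludes leaders below. *)
        assert (Hrj : ~ reached j).
        { intros Hrj. apply Hri. apply (reach_step _ _ _ _ j); [exact Hrj | exact Hi|].
          exists t. split; [lra | exact Harc]. }
        specialize (Hmin j Hj). unfold th in Hmin. rewrite Ei in Hmin.
        destruct (excluded_middle_informative (reached j)) as [Hrj'|_]; [now destruct Hrj|].
        destruct Hw as [Hwa _]. destruct (Hwa i j Hi Hj) as [_ Hb1].
        specialize (Hb1 (first_coord (fun j => x j t)) origin t).
        apply Rmult_le_pos; [unfold al; lra | lra].
      + destruct (arcL (sigma t) j i) eqn:Harc; [|lra]. exfalso. apply Hri.
        apply (reach_leader _ _ _ _ j); [exact Hj | exact Hi|].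
        exists t. split; [lra | exact Harc].
    - intros i Hi. unfold th. destruct (excluded_middle_informative (reached i)); [lra|].
      destruct (Hbd i t0 Hi Ht0) as [Hx _]. lra. }
  unfold th in Hth. destruct (excluded_middle_informative (reached i0)) as [H|_]; [now apply Hnr|].
  specialize (HC i0 (t0 + T) Hi0 ltac:(lra)). unfold T in *. lra.
Qed.

End Necessity.

Theorem theorem1 (n k d : nat) (Hn : (2 <= n)%nat) (Hk : (1 <= k)%nat) (Hd : (1 <= d)%nat)
  (sigma : R -> digraph) (tauD : R) (HtauD : 0 < tauD)
  (Hfin : finite_valued sigma) (Hdwell : dwell_time sigma tauD)
  (a b : weight) (a_lo a_hi b_lo : R)
  (Ha : 0 < a_lo /\ a_lo <= a_hi) (Hb : 0 < b_lo)
  (Hw : weights_ok n k d a b a_lo a_hi b_lo) :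
  SISS n k d sigma a b <-> UJLC n k sigma.
Proof.
  destruct Ha as [Ha0 Ha1]. split.
  - now apply (SISS_UJLC n k d sigma tauD a b a_lo a_hi b_lo).
  - now apply (UJLC_SISS n k d sigma tauD a b a_lo a_hi b_lo).
Qed.
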